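(* Let $G$ be a connected graph with $\chi(G)=2$. Then $G$ is enumeratively chromatic-choosable if and only if the core of $G$ is isomorphic to one of: $K_1$; the cycle $C_{2k+2}$ for some $k \in \mathbb{N}=\{1,2,3,\dots\}$; or $K_{2,3}$.
   Context: All graphs are finite, simple and nonempty. A list assignment $L$ for $G$ assigns to each vertex $v$ a set $L(v)$ of colors; it is an $m$-assignment if $|L(v)|=m$ for all $v$. A proper $L$-coloring is a proper coloring $f$ with $f(v)\in L(v)$ for all $v$; $P(G,L)$ is the number of proper $L$-colorings. $P(G,m)$ is the chromatic polynomial (number of proper colorings with colors from $\{1,\dots,m\}$), and the list color function $P_\ell(G,m)$ is the minimum of $P(G,L)$ over all $m$-assignments $L$ of $G$. A graph $G$ is enumeratively chromatic-choosable if $P_\ell(G,m)=P(G,m)$ for every integer $m\ge \chi(G)$. The core of a connected graph $G$ is the graph obtained from $G$ by successively deleting vertices of degree 1 (the core of a tree is $K_1$). *)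

(* Defs.v *)
(* Simple graphs = symmetric irreflexive relations on a finType. *)
From mathcomp Require Import all_boot.
Set Implicit Arguments. Unset Strict Implicit. Unset Printing Implicit Defensive.

Section Graphs.
Variable T : finType.
Variable e : rel T.

Definition proper (C : Type) (f : T -> C) : Prop :=
  forall u v, e u v -> f u <> f v.

Definition properb (n : nat) (f : {ffun T -> 'I_n}) : bool :=
  [forall u, forall v, e u v ==> (f u != f v)].

Definition colorable (k : nat) : Prop :=
  exists f : T -> 'I_k, proper f.

Definition chromatic_number (k : nat) : Prop :=
  colorable k /\ forall j, j < k -> ~ colorable j.

Definition chrom_poly (m : nat) : nat :=
  #|[set f : {ffun T -> 'I_m} | properb f]|.

(* A list assignment with colors from the finite set {0..N-1} of naturals
   (colors are natural numbers; every finite list assignment with natural-number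
   colors uses colors below some N). *)
Definition m_assignment (m N : nat) (L : T -> {set 'I_N}) : Prop :=
  forall v, #|L v| = m.

Definition P_list (N : nat) (L : T -> {set 'I_N}) : nat :=
  #|[set f : {ffun T -> 'I_N} | [forall v, f v \in L v] && properb f]|.

Definition list_color_function_is (m p : nat) : Prop :=
  (exists N (L : T -> {set 'I_N}), m_assignment m L /\ P_list L = p) /\
  (forall N (L : T -> {set 'I_N}), m_assignment m L -> p <= P_list L).

Definition enum_chromatic_choosable : Prop :=
  forall k m, chromatic_number k -> k <= m ->
    list_color_function_is m (chrom_poly m).

Definition deg_in (S : {set T}) (v : T) : nat := #|[set u in S | e v u]|.

Definition core_step (S : {set T}) : {set T} :=
  if [pick v in S | deg_in S v == 1] is Some v then S :\ v else S.

Definition core : {set T} := iter #|T| core_step setT.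

Definition induced_iso (S : {set T}) (n : nat) (r : rel 'I_n) : Prop :=
  exists h : 'I_n -> T,
    injective h /\ (forall x, x \in S <-> exists i, h i = x) /\
    forall i j, r i j = e (h i) (h j).

Definition connected : Prop := forall x y, connect e x y.

End Graphs.

Definition K1_rel : rel 'I_1 := fun _ _ => false.
Definition cycle_rel (n : nat) : rel 'I_n :=
  fun i j => ((i.+1 %% n) == j) || ((j.+1 %% n) == i).
Definition K23_rel : rel 'I_5 := fun i j => (i < 2) != (j < 2).
Arguments cycle_rel n : clear implicits.

(* Main.v *)
(** A cycle or K_{2,3} with m-element lists has at least as many list colourings
    as with constant lists (by counting closed walks, resp. the colours
    left at each vertex of the larger side), and a pendant vertex never spoils
    this, which settles one direction.  Conversely, a connected bipartite graph
    has two 2-colourings, so it suffices to find a 2-assignment with at most one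
    colouring; giving a new vertex the list of a neighbour shows that a
    subgraph with such an assignment is enough.  Two cycles joined by a path,
    thetas other than K_{2,3}, and K_{2,4} have one, and ears or lollipops
    attached to a cycle or to K_{2,3} inside the core always produce
    one of these. *)
Require Import Defs.
From mathcomp Require Import all_boot zify.
Set Implicit Arguments. Unset Strict Implicit. Unset Printing Implicit Defensive.

Section SpareColors.
Variable C : finType.
Implicit Types (A B L : {set C}) (a b c : C).

(* The number of colours of an m-element list [L] outside {a, b}, in excess of
   [m - 2]; see [card_setD_pair]. *)
Definition gain L a b : nat :=
  if a == b then (a \notin L).+1 else (a \notin L) + (b \notin L).

Lemma gain_sym L a b : gain L a b = gain L b a.
Proof. by rewrite /gain eq_sym; case: eqP => [->|] //; rewrite addnC. Qed.

Lemma gain_notinl L a b : a \notin L -> 0 < gain L a b.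
Proof. by rewrite /gain => ->; case: ifP. Qed.

Lemma card_setD_pair m L a b : 1 < m -> #|L| = m ->
  #|[set x in L | (x != a) && (x != b)]| = m - 2 + gain L a b.
Proof.
move=> m1 Lm; rewrite /gain.
have -> : [set x in L | (x != a) && (x != b)] = (L :\ a) :\ b.
  by apply/setP => x; rewrite !inE; do !case: eqP => //=; rewrite andbC.
have h1 := cardsD1 a L; have h2 := cardsD1 b (L :\ a).
move: h1 h2; rewrite !inE Lm (eq_sym b).
by case: (eqVneq a b) => [->|_] /=; case: (b \in L); try case: (a \in L); lia.
Qed.

Lemma sum_gain3_common m A B L1 L2 L3 a : #|B| = m -> a \in A ->
  a \notin L1 -> a \notin L2 -> a \notin L3 ->
  m <= \sum_(x in A) \sum_(b in B) gain L1 x b * gain L2 x b * gain L3 x b.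
Proof.
move=> Bm aA a1 a2 a3; rewrite (bigD1 a) //= -Bm -sum1_card.
apply: leq_trans (leq_addr _ _); apply: leq_sum => b _.
by rewrite !muln_gt0 !gain_notinl.
Qed.

Definition miss2 L1 L2 L3 a : bool :=
  [|| (a \notin L1) && (a \notin L2), (a \notin L1) && (a \notin L3)
    | (a \notin L2) && (a \notin L3)].

Lemma sum_gain3_ge m A B L1 L2 L3 :
  #|A| = m -> #|B| = m -> #|L1| = m -> #|L2| = m -> #|L3| = m ->
  m <= \sum_(a in A) \sum_(b in B) gain L1 a b * gain L2 a b * gain L3 a b.
Proof.
move=> Am Bm m1 m2 m3.
pose tri x := [&& x \notin L1, x \notin L2 & x \notin L3].
have [/existsP[a /and4P[aA a1 a2 a3]]|noA] := boolP [exists x, (x \in A) && tri x].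
  exact: (sum_gain3_common Bm aA).
have [/existsP[b /and4P[bB b1 b2 b3]]|noB] := boolP [exists x, (x \in B) && tri x].
  rewrite exchange_big /=; apply: leq_trans (sum_gain3_common Am bB b1 b2 b3) _.
  by apply: leq_sum => x _; apply: leq_sum => y _; rewrite !(gain_sym _ x).
have triA x : x \in A -> ~~ tri x.
  by move=> xA; apply/negP => tx; case/existsP: noA; exists x; rewrite xA.
have triB x : x \in B -> ~~ tri x.
  by move=> xB; apply/negP => tx; case/existsP: noB; exists x; rewrite xB.
pose nm x := (x \notin L1) + (x \notin L2) + (x \notin L3).
pose Y a b := ((a \notin L1) && (a \notin L2)) * (b \notin L3)
   + ((a \notin L1) && (a \notin L3)) * (b \notin L2)
   + ((a \notin L2) && (a \notin L3)) * (b \notin L1).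
pose low a b := (a == b) * (nm a).+1 + (a \notin B) * Y a b + (b \notin A) * Y b a.
have step1 : \sum_(a in A) \sum_(b in B) low a b <=
    \sum_(a in A) \sum_(b in B) gain L1 a b * gain L2 a b * gain L3 a b.
  apply: leq_sum => a aA; apply: leq_sum => b bB.
  rewrite /low /gain /nm /Y; case: (eqVneq a b) => [eab|nab].
    by move: bB; rewrite -eab aA => ->;
      case: (a \in L1); case: (a \in L2); case: (a \in L3).
  have := triA a aA; have := triB b bB; rewrite /tri.
  by case: (a \in L1); case: (a \in L2); case: (a \in L3); case: (b \in L1);
    case: (b \in L2); case: (b \in L3); case: (a \in B); case: (b \in A).
apply: leq_trans step1.
have Ymiss A' B' : #|A'| = m -> #|B'| = m -> (forall x, x \in A' -> ~~ tri x) ->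
    \sum_(a in A' :\: B') (miss2 L1 L2 L3 a : nat) <=
    \sum_(a in A') \sum_(b in B') (a \notin B') * Y a b.
  move=> Am' Bm' triA'.
  rewrite [leqRHS](bigID (mem B')) /= addnC.
  rewrite (eq_bigl (fun i => (i \in A') && (i \notin B'))); last first.
    by move=> i; rewrite !inE andbC.
  apply: leq_trans (leq_addr _ _); apply: leq_sum => a /andP[aA aB].
  under eq_bigr do rewrite aB mul1n.
  have Bmiss L : #|L| = m -> a \in L -> exists2 b, b \in B' & b \notin L.
    move=> Lm aL; apply/subsetPn; apply: contra aB => BL.
    have /eqP -> : B' == L by rewrite eqEcard BL Bm' Lm leqnn.
    by [].
  have := triA' _ aA; rewrite /miss2 /tri /Y.
  case a1 : (a \in L1); case a2 : (a \in L2); case a3 : (a \in L3) => //= _.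
  - by have [b bB bL] := Bmiss _ m1 a1; rewrite (bigD1 b) //= bL.
  - by have [b bB bL] := Bmiss _ m2 a2; rewrite (bigD1 b) //= bL.
  - by have [b bB bL] := Bmiss _ m3 a3; rewrite (bigD1 b) //= bL.
have YA := Ymiss _ _ Am Bm triA; have YB := Ymiss _ _ Bm Am triB.
rewrite /low; under eq_bigr do rewrite !big_split /=.
rewrite !big_split /= [X in _ <= _ + X]exchange_big /=.
have diag : \sum_(c in A :&: B) (nm c).+1 <=
    \sum_(a in A) \sum_(b in B) (a == b) * (nm a).+1.
  rewrite [leqRHS](bigID (mem B)) /=.
  rewrite (eq_bigl (fun i => (i \in A) && (i \in B))); last by move=> i; rewrite !inE.
  apply: leq_trans (leq_addr _ _); apply: leq_sum => a /andP[aA aB].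
  by rewrite (bigD1 a) //= eqxx mul1n leq_addr.
apply: leq_trans (leq_add (leq_add diag YA) YB).
have miss_ge (D : {set C}) : {in D, forall x, ~~ tri x} ->
    \sum_(x in D) nm x <= \sum_(x in D) (miss2 L1 L2 L3 x : nat) + #|D|.
  move=> triD; rewrite -sum1_card -big_split /=; apply: leq_sum => x /triD.
  by rewrite /tri /nm /miss2; case: (x \in L1); case: (x \in L2); case: (x \in L3).
have hA : \sum_(x in A :\: B) nm x <= _ := miss_ge (A :\: B) _.
have {}hA := hA (fun x xD => triA x (subsetP (subsetDl A B) x xD)).
have hB := miss_ge (B :\: A) (fun x xD => triB x (subsetP (subsetDl B A) x xD)).
have cards_miss L : #|L| = m -> #|A :|: B| - m <= \sum_(x in A :|: B) (x \notin L : nat).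
  move=> Lm; rewrite -sum1_card.
  have := leq_sub2l #|A :|: B| (subset_leq_card (subsetIr (A :|: B) L)).
  rewrite Lm => /leq_trans; rewrite sum1_card; apply.
  rewrite -cardsD -sum1_card big_mkcond [leqRHS]big_mkcond /=.
  by apply: leq_sum => x _; rewrite !inE; case: (x \in A); case: (x \in B); case: (x \in L).
have tot : \sum_(x in A :|: B) nm x =
    \sum_(x in A :&: B) nm x + \sum_(x in A :\: B) nm x + \sum_(x in B :\: A) nm x.
  rewrite !(big_mkcond (fun x => x \in _)) /= -!big_split /=.
  by apply: eq_bigr => x _; rewrite !inE; case: (x \in A); case: (x \in B); rewrite /= ?addn0.
have nmE : \sum_(x in A :|: B) nm x >= 3 * (#|A :|: B| - m).
  rewrite /nm !big_split /=.
  by have := cards_miss _ m1; have := cards_miss _ m2; have := cards_miss _ m3; lia.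
have -> : \sum_(c in A :&: B) (nm c).+1 = #|A :&: B| + \sum_(c in A :&: B) nm c.
  by rewrite -sum1_card -big_split.
have := cardsID B A; have := cardsID A B; rewrite Am Bm (setIC B A).
have := cardsUI A B; rewrite Am Bm; lia.
Qed.

Lemma sum_gain2_ge m A B L1 L2 :
  #|A| = m -> #|B| = m -> #|L1| = m -> #|L2| = m ->
  m <= \sum_(a in A) \sum_(b in B) gain L1 a b * gain L2 a b.
Proof.
move=> Am Bm m1 m2; apply: leq_trans (sum_gain3_ge Am Bm m1 m2 Am) _.
apply: leq_sum => a aA; apply: leq_sum => b _.
rewrite -[leqRHS]muln1 leq_mul2l orbC /gain aA.
by case: eqP => // _; rewrite add0n leq_b1.
Qed.

Lemma sum_gain1_ge m A B L :
  #|A| = m -> #|B| = m -> #|L| = m ->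
  m <= \sum_(a in A) \sum_(b in B) gain L a b.
Proof.
move=> Am Bm Lm; apply: leq_trans (sum_gain2_ge Am Bm Lm Am) _.
apply: leq_sum => a aA; apply: leq_sum => b _.
rewrite -[leqRHS]muln1 leq_mul2l orbC /gain aA.
by case: eqP => // _; rewrite add0n leq_b1.
Qed.

Definition sum_pairs (L1 L2 L3 A B : {set C}) : nat :=
  \sum_(a in A) \sum_(b in B)
    #|[set x in L1 | (x != a) && (x != b)]| *
    #|[set x in L2 | (x != a) && (x != b)]| *
    #|[set x in L3 | (x != a) && (x != b)]|.

Lemma sum_pairs_expand m A B L1 L2 L3 : 1 < m ->
  #|A| = m -> #|B| = m -> #|L1| = m -> #|L2| = m -> #|L3| = m ->
  sum_pairs L1 L2 L3 A B =
    m * m * (m - 2) ^ 3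
  + (m - 2) ^ 2 * (\sum_(a in A) \sum_(b in B) gain L1 a b
     + \sum_(a in A) \sum_(b in B) gain L2 a b
     + \sum_(a in A) \sum_(b in B) gain L3 a b)
  + (m - 2) * (\sum_(a in A) \sum_(b in B) gain L1 a b * gain L2 a b
     + \sum_(a in A) \sum_(b in B) gain L1 a b * gain L3 a b
     + \sum_(a in A) \sum_(b in B) gain L2 a b * gain L3 a b)
  + \sum_(a in A) \sum_(b in B) gain L1 a b * gain L2 a b * gain L3 a b.
Proof.
move=> m_gt1 Am Bm m1 m2 m3.
have -> : m * m * (m - 2) ^ 3 = \sum_(a in A) \sum_(b in B) (m - 2) ^ 3.
  by rewrite !sum_nat_const Am Bm mulnA.
rewrite -!big_split /= !big_distrr -!big_split /=.
apply: eq_bigr => a _.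
rewrite -!big_split /= !big_distrr -!big_split /=.
apply: eq_bigr => b _; rewrite !(card_setD_pair _ _ m_gt1) //; lia.
Qed.

Lemma sum_pairs_ge m A B L1 L2 L3 : 1 < m ->
  #|A| = m -> #|B| = m -> #|L1| = m -> #|L2| = m -> #|L3| = m ->
  m * m * (m - 2) ^ 3 + (m - 2) ^ 2 * (3 * m) + (m - 2) * (3 * m) + m
   <= sum_pairs L1 L2 L3 A B.
Proof.
move=> m_gt1 Am Bm m1 m2 m3; rewrite (sum_pairs_expand m_gt1) //.
rewrite leq_add ?sum_gain3_ge // leq_add // ?leq_add2l ?leq_mul //.
  have := sum_gain1_ge Am Bm m1; have := sum_gain1_ge Am Bm m2.
  by have := sum_gain1_ge Am Bm m3; lia.
have := sum_gain2_ge Am Bm m1 m2; have := sum_gain2_ge Am Bm m1 m3.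
by have := sum_gain2_ge Am Bm m2 m3; lia.
Qed.

End SpareColors.

Lemma sum_pairs_const m : 1 < m ->
  sum_pairs [set: 'I_m] setT setT setT setT =
  m * m * (m - 2) ^ 3 + (m - 2) ^ 2 * (3 * m) + (m - 2) * (3 * m) + m.
Proof.
move=> m_gt1; have cT : #|[set: 'I_m]| = m by rewrite cardsT card_ord.
rewrite (sum_pairs_expand m_gt1) //.
have gE a b : gain [set: 'I_m] a b = (a == b) by rewrite /gain !inE; case: eqP.
have s1 : \sum_(a in [set: 'I_m]) \sum_(b in [set: 'I_m]) (a == b : nat) = m.
  rewrite -[RHS]cT -sum1_card; apply: eq_bigr => a _.
  rewrite (bigD1 a) ?inE //= eqxx big1 // => b /andP[_ /negPf].
  by rewrite eq_sym => ->.
have sE (F : 'I_m -> 'I_m -> nat) : (forall a b, F a b = (a == b)) ->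
    \sum_(a in [set: 'I_m]) \sum_(b in [set: 'I_m]) F a b = m.
  by move=> FE; rewrite -[RHS]s1; apply: eq_bigr => a _; apply: eq_bigr => b _.
rewrite !sE // => [|a b|a b]; rewrite ?gE ?mulnb ?andbb //.
by rewrite (_ : m + m + m = 3 * m) //; lia.
Qed.

Section Walks.
Variable C : finType.
Implicit Types (A B D E F L : {set C}) (ls : seq {set C}) (a b c z : C).

Fixpoint walks z c ls : nat :=
  if ls is A :: ls' then \sum_(a in A | a != c) walks z a ls' else (c != z).

Definition closed_walks A ls : nat := \sum_(c in A) walks c c ls.

Lemma walks1 z c A : walks z c [:: A] = #|[set x in A | (x != c) && (x != z)]|.
Proof.
rewrite /= -sum1_card [RHS]big_mkcond /= big_mkcond /=; apply: eq_bigr => x _.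
by rewrite !inE; case: (x \in A); case: eqP; case: eqP.
Qed.

Lemma card_neq_ge m A c : #|A| = m -> m.-1 <= #|[pred a | (a \in A) && (a != c)]|.
Proof.
move=> Am; have := cardsD1 c A; rewrite Am => ->.
suff -> : #|[pred a | (a \in A) && (a != c)]| = #|A :\ c| by case: (c \in A); rewrite ?leq_pred.
by apply: eq_card => a; rewrite !inE andbC.
Qed.

Lemma sum_neq_ge m A c (F0 : C -> nat) k : #|A| = m ->
  (forall a, a \in A -> k <= F0 a) -> m.-1 * k <= \sum_(a in A | a != c) F0 a.
Proof.
move=> Am Fk; apply: leq_trans (_ : \sum_(a in A | a != c) k <= _).
  by rewrite sum_nat_const leq_mul2r card_neq_ge ?orbT.
by apply: leq_sum => a /andP[/Fk].
Qed.

Lemma sum_pair_le A a x (F0 : C -> nat) : a \in A -> x \in A -> x != a ->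
  F0 a + F0 x <= \sum_(c in A) F0 c.
Proof.
move=> aA xA xa; rewrite (bigD1 a) //= leq_add2l (bigD1 x) /= ?xA ?xa //.
exact: leq_addr.
Qed.

Lemma walks_ge m z c A ls : 1 < m -> {in A :: ls, forall B, #|B| = m} ->
  (m - 2) * m.-1 ^ size ls <= walks z c (A :: ls).
Proof.
move=> m_gt1; elim: ls A c => [|B ls IH] A c lsm.
  by rewrite walks1 (card_setD_pair _ _ m_gt1) ?lsm ?inE // muln1 leq_addr.
have -> : (m - 2) * m.-1 ^ size (B :: ls) = m.-1 * ((m - 2) * m.-1 ^ size ls).
  by rewrite /= expnS; lia.
apply: sum_neq_ge => [|a _]; first by rewrite lsm ?inE ?eqxx.
by apply: IH => D Dls; apply: lsm; rewrite inE Dls orbT.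
Qed.

Lemma walks_ge_notin_last m z c A ls : {in A :: ls, forall B, #|B| = m} ->
  z \notin last A ls -> m.-1 ^ (size ls).+1 <= walks z c (A :: ls).
Proof.
elim: ls A c => [|B ls IH] A c lsm zA.
  rewrite expn1 -[m.-1]muln1; apply: sum_neq_ge => [|a aA] /=.
    by rewrite lsm ?inE.
  by case: eqP aA zA => // -> /= ->.
rewrite expnS; apply: sum_neq_ge => [|a _]; first by rewrite lsm ?inE ?eqxx.
by apply: IH => // D Dls; apply: lsm; rewrite inE Dls orbT.
Qed.

Lemma walks2_ge_but_one m z a1 a2 A B : 1 < m -> #|A| = m -> #|B| = m -> a1 != a2 ->
  exists2 a, a \in [:: a1; a2] & (m - 2) * m.-1 < walks z a [:: A; B].
Proof.
move=> m_gt1 Am Bm a12.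
have good a b : b \in A -> b != a -> 0 < gain B b z ->
    (m - 2) * m.-1 < walks z a [:: A; B].
  move=> bA ba gb; rewrite -[walks _ _ _]/(\sum_(x in A | x != a) walks z x [:: B]).
  under eq_bigr do rewrite walks1 (card_setD_pair _ _ m_gt1) //.
  rewrite big_split /= sum_nat_const.
  have := card_neq_ge a Am.
  rewrite (bigD1 b) /=; last by rewrite bA.
  rewrite mulnC -(leq_pmul2r (m := m - 2 + 1)); last lia.
  set k := #|_| => hk.
  have : m.-1 * (m - 2) <= k * (m - 2) by rewrite leq_mul2r -(leq_pmul2r (m := m - 2 + 1)) ?hk ?orbT //; lia.
  lia.
have [b /andP[bA gb] | none] := pickP [pred b | (b \in A) && (0 < gain B b z)].
  have [eb|nb] := eqVneq b a1.
    by exists a2; rewrite ?inE ?eqxx ?orbT //; apply: (good _ b); rewrite // eb.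
  by exists a1; rewrite ?inE ?eqxx //; apply: (good _ b).
have g0 b : b \in A -> gain B b z = 0.
  by move=> bA; have := none b; rewrite /= bA lt0n => /negbFE/eqP.
have AB : A = B.
  apply/eqP; rewrite eqEcard Am Bm leqnn andbT; apply/subsetP => b bA.
  by have := g0 b bA; rewrite /gain; case: eqP => // _; case: (b \in B).
have [b bA] : exists b, b \in A by apply/set0Pn; rewrite -card_gt0 Am ltnW.
have zB : z \in B.
  by have := g0 b bA; rewrite /gain; case: eqP => // _; case: (z \in B) => //; rewrite addn1.
by have := g0 z; rewrite AB zB /gain eqxx => /(_ isT).
Qed.

Lemma walks_gt m z c A B D ls : 2 < m ->
  {in [:: A, B, D & ls], forall E, #|E| = m} ->
  (m - 2) * m.-1 ^ (size ls).+2 < walks z c [:: A, B, D & ls].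
Proof.
move=> m_gt2; elim: ls A B D c => [|E ls IH] A B D c lsm; last first.
  apply: leq_trans (_ : m.-1 * ((m - 2) * m.-1 ^ (size ls).+2).+1 <= _).
    by rewrite [size _]/= expnS; lia.
  apply: sum_neq_ge => [|a _]; first by rewrite lsm ?inE ?eqxx.
  by apply: IH => F Fls; apply: lsm; rewrite inE Fls orbT.
have Am : #|A| = m by rewrite lsm ?inE ?eqxx.
have : 1 < #|[set a in A | a != c]|.
  have -> : #|[set a in A | a != c]| = #|[pred a | (a \in A) && (a != c)]|.
    by apply: eq_card => a; rewrite !inE.
  by have := card_neq_ge c Am; lia.
case/card_gt1P => a1 [a2 []]; rewrite !inE => a1A a2A a12.
have Bm : #|B| = m by rewrite lsm ?inE ?eqxx ?orbT.
have Dm : #|D| = m by rewrite lsm ?inE ?eqxx ?orbT.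
have [a a_in wa] := walks2_ge_but_one z (ltnW m_gt2) Bm Dm a12.
have aA : (a \in A) && (a != c) by move: a_in; rewrite !inE => /orP[]/eqP ->.
rewrite -[walks _ _ _]/(\sum_(x in A | x != c) walks z x [:: B; D]).
have ge x : (m - 2) * m.-1 <= walks z x [:: B; D].
  rewrite -{1}(expn1 m.-1); apply: (@walks_ge m z x B [:: D]); first exact: ltnW.
  by move=> E E_in; apply: lsm; rewrite inE E_in orbT.
have rest : (m - 2) * ((m - 2) * m.-1) <=
    \sum_(i | (i \in A) && (i != c) && (i != a)) walks z i [:: B; D].
  apply: leq_trans (_ : \sum_(i | (i \in A) && (i != c) && (i != a)) ((m - 2) * m.-1) <= _).
    rewrite sum_nat_const leq_mul2r; apply/orP; right.
    rewrite -(leq_add2r (gain A c a)) -(card_setD_pair c a (ltnW m_gt2) Am).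
    by apply: leq_trans (leq_addr _ _); apply: eq_leq; apply: eq_card => x; rewrite !inE andbA.
  by apply: leq_sum => i _; apply: ge.
rewrite (bigD1 a) //; apply: leq_trans (leq_add wa rest).
have -> : m.-1 = (m - 2).+1 by lia.
by rewrite /= !expnS expn0; lia.
Qed.

Lemma walks_from_some A z ls : 1 < #|A| -> {in ls, forall B, 1 < #|B|} ->
  exists2 y, y \in A & 0 < walks z y ls.
Proof.
have pick_neq (B : {set C}) x : 1 < #|B| -> exists2 y, y \in B & y != x.
  case/card_gt1P => y1 [y2 [y1B y2B y12]].
  by have [e|n] := eqVneq y1 x; [exists y2; rewrite // -e eq_sym | exists y1].
elim: ls A => [|B ls IH] A A2 lsm.
  by have [y yA yz] := pick_neq A z A2; exists y; rewrite //= yz.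
have [|D Dls|x xB wx] := IH B; first by apply: lsm; rewrite inE eqxx.
  by apply: lsm; rewrite inE Dls orbT.
have [y yA yx] := pick_neq A x A2; exists y => //=.
by rewrite (bigD1 x) /= 1?eq_sym ?xB ?yx // ltn_addr.
Qed.

Lemma walks_from_one_to_all A B ls : {in [:: A, B & ls], forall D, #|D| = 2} ->
  A != last B ls -> exists2 x, x \in A & forall z, 0 < walks z x (B :: ls).
Proof.
elim: ls A B => [|D ls IH] A B lsm AB.
  have [x xA xB] : exists2 x, x \in A & x \notin B.
    apply/subsetPn; apply: contra AB => sAB.
    by rewrite eqEcard sAB !lsm ?inE ?eqxx ?orbT.
  exists x => // z.
  have [| |y yB wy] := @walks_from_some B z [::] => //.
    by rewrite lsm ?inE ?eqxx ?orbT.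
  rewrite /= (bigD1 y) /=; first by apply: ltn_addr.
  by rewrite yB; apply: contraNneq xB => <-.
have [eB|nB] := eqVneq B (last D ls); last first.
  have [|y yB wy] := IH B D _ nB; first by move=> E Els; apply: lsm; rewrite inE Els orbT.
  have : 0 < #|A :\ y| by have := cardsD1 y A; rewrite lsm ?inE ?eqxx //; case: (y \in A); lia.
  case/card_gt0P => x; rewrite !inE => /andP[xy xA]; exists x => // z.
  rewrite -[walks _ _ _]/(\sum_(a in B | a != x) walks z a (D :: ls)).
  have yx : (y \in B) && (y != x) by rewrite yB eq_sym.
  by rewrite (bigD1 y yx); apply: ltn_addr.
have [x xA xB] : exists2 x, x \in A & x \notin B.
  apply/subsetPn; apply: contra AB => sAB; rewrite /= -eB.
  by rewrite eqEcard sAB !lsm ?inE ?eqxx ?orbT.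
exists x => // z.
have [||y yB wy] := @walks_from_some B z (D :: ls).
- by rewrite lsm ?inE ?eqxx ?orbT.
- by move=> E Els; rewrite lsm // inE [_ \in B :: _]inE Els !orbT.
rewrite -[walks _ _ _]/(\sum_(a in B | a != x) walks z a (D :: ls)).
rewrite (bigD1 y) /=; first exact: ltn_addr.
by rewrite yB; apply: contraNneq xB => <-.
Qed.

Lemma walks_notin_last z z1 z2 c A ls : z1 != z2 -> last A ls = [set z1; z2] ->
  z \notin last A ls -> walks z1 c (A :: ls) + walks z2 c (A :: ls) <= walks z c (A :: ls).
Proof.
move=> z12; elim: ls A c => [|B ls IH] A c.
  move=> /= AE zA; rewrite -big_split /=; apply: leq_sum => a /andP[aA _].
  have az : a != z by apply: contraNneq zA => <-.
  move: aA; rewrite AE az !inE => /orP[]/eqP ->; rewrite eqxx.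
    by rewrite leq_b1.
  by rewrite addn0 leq_b1.
move=> lE zl; rewrite -[walks z _ _]/(\sum_(a in A | a != c) walks z a (B :: ls)).
rewrite -big_split /=; apply: leq_sum => a _; exact: IH.
Qed.

Lemma closed_walks_ge2 A B ls : {in [:: A, B & ls], forall D, #|D| = 2} ->
  A != last B ls -> 1 < closed_walks A (B :: ls).
Proof.
move=> lsm AB.
have lastm : #|last B ls| = 2 by apply: lsm; rewrite inE mem_last orbT.
have [a aA al] : exists2 x, x \in A & x \notin last B ls.
  apply/subsetPn; apply: contra AB => sA.
  by rewrite eqEcard sA lastm lsm ?inE ?eqxx.
have wa : 0 < walks a a (B :: ls).
  rewrite -(exp1n (size ls).+1); apply: (@walks_ge_notin_last 2) => // D Dls.
  by apply: lsm; rewrite inE Dls orbT.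
have [x xA wx] := walks_from_one_to_all lsm AB.
have [xa|xa] := eqVneq x a; last first.
  apply: leq_trans (sum_pair_le (fun c => walks c c (B :: ls)) aA xA xa).
  exact: leq_add wa (wx x).
have /cards2P[z1 [z2 [z12 lE]]] : #|last B ls| == 2.
  by rewrite lastm.
apply: leq_trans (_ : walks a a (B :: ls) <= _); last first.
  by rewrite /closed_walks (bigD1 a aA); exact: leq_addr.
apply: leq_trans (walks_notin_last a z12 lE al).
by rewrite -xa; apply: leq_add (wx z1) (wx z2).
Qed.

Lemma closed_walks_ge m A B D E ls : 1 < m ->
  {in [:: A, B, D, E & ls], forall F, #|F| = m} -> A != last E ls ->
  m.-1 ^ (size ls).+4 + m.-1 <= closed_walks A [:: B, D, E & ls].
Proof.
move=> m_gt1; have [m2|] := leqP m 2.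
  have -> : m = 2 by lia.
  by move=> lsm AE; rewrite exp1n; apply: closed_walks_ge2.
move=> m_gt2 lsm AE.
have lsm' : {in [:: B, D, E & ls], forall F, #|F| = m}.
  by move=> F Fin; apply: lsm; rewrite inE Fin orbT.
have Am : #|A| = m by rewrite lsm ?inE ?eqxx.
have lastm : #|last E ls| = m by apply: lsm; rewrite 3!inE mem_last !orbT.
have [a aA al] : exists2 x, x \in A & x \notin last E ls.
  apply/subsetPn; apply: contra AE => sA.
  by rewrite eqEcard sA Am lastm leqnn.
rewrite /closed_walks (bigD1 a aA).
have h1 := @walks_ge_notin_last m a a B (D :: E :: ls) lsm' al.
have h2 := sum_neq_ge (F0 := fun c => walks c c [:: B, D, E & ls]) a Am
   (fun c _ => walks_gt c c m_gt2 lsm').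
apply: leq_trans (leq_add h1 h2) => /=.
have -> : m.-1 = (m - 2).+1 by lia.
rewrite !(expnS _ (size ls).+3) !(expnS _ (size ls).+2).
by move: (m - 2) (_ ^ _.+2) => k X; lia.
Qed.

Lemma walks_const m A z c k : #|A| = m -> c \in A -> z \in A ->
  if odd k then m * walks z c (nseq k A) + 1 = m.-1 ^ k.+1 + m * (c == z)
  else m * walks z c (nseq k A) + m * (c == z) = m.-1 ^ k.+1 + 1.
Proof.
move=> Am; elim: k c => [|k IH] c cA zA.
  rewrite /= expn1; have : 0 < m by rewrite -Am card_gt0; apply/set0Pn; exists c.
  by case: eqP => _ /=; lia.
have cardE : #|[pred a | (a \in A) && (a != c)]| = m.-1.
  have := cardsD1 c A; rewrite cA Am => -> /=.
  by apply: eq_card => a; rewrite !inE andbC.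
have zE : \sum_(a in A | a != c) (a == z : nat) = (c != z).
  have [cz|cz] := eqVneq c z.
    by rewrite big1 // => a /andP[_ /negPf]; rewrite cz => ->.
  rewrite (bigD1 z) /=; last by rewrite zA eq_sym.
  by rewrite eqxx big1 // => a /andP[_ /negPf ->].
have mE : 0 < m by rewrite -Am card_gt0; apply/set0Pn; exists c.
have zm : m * (c != z) + m * (c == z) = m by case: eqP => _ /=; lia.
rewrite [walks _ _ _]/=; set S := \sum_(_ in _ | _) _.
have {IH} : \sum_(a in A | a != c)
   (if odd k then m * walks z a (nseq k A) + 1 else m * walks z a (nseq k A) + m * (a == z))
   = \sum_(a in A | a != c)
   (if odd k then m.-1 ^ k.+1 + m * (a == z) else m.-1 ^ k.+1 + 1).
  by apply: eq_bigr => a /andP[aA _]; have := IH a aA zA; case: odd.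
rewrite /= (expnS _ k.+1); case: (odd k) => /=.
  rewrite !big_split /= -!big_distrr /= -/S zE !sum_nat_const cardE muln1; lia.
by rewrite !big_split /= -!big_distrr /= -/S zE !sum_nat_const cardE; lia.
Qed.

Lemma closed_walks_const m A k : 0 < m -> #|A| = m -> odd k ->
  closed_walks A (nseq k A) = m.-1 ^ k.+1 + m.-1.
Proof.
move=> m_gt0 Am ok.
have /card_gt0P[c0 c0A] : 0 < #|A| by rewrite Am.
have E c : c \in A -> walks c c (nseq k A) = walks c0 c0 (nseq k A).
  move=> cA; have := walks_const k Am cA cA; have := walks_const k Am c0A c0A.
  by rewrite ok !eqxx; nia.
rewrite /closed_walks (eq_bigr _ E) sum_nat_const Am.
by have := walks_const k Am c0A c0A; rewrite ok eqxx; lia.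
Qed.

Lemma closed_walks_min m A B D E ls : 1 < m -> odd (size ls) = false ->
  {in [:: A, B, D, E & ls], forall F, #|F| = m} ->
  A != last E ls \/ [:: B, D, E & ls] = nseq (size ls).+3 A ->
  m.-1 ^ (size ls).+4 + m.-1 <= closed_walks A [:: B, D, E & ls].
Proof.
move=> m_gt1 os lsm [|->]; first exact: closed_walks_ge.
rewrite (closed_walks_const (ltnW m_gt1)) //=; last by rewrite os.
by apply: lsm; rewrite inE eqxx.
Qed.
End Walks.

Fixpoint list_count (C : finType) (ls : seq {set C}) (Q : seq C -> bool) : nat :=
  if ls is A :: ls' then \sum_(a in A) list_count ls' (fun s => Q (a :: s))
  else Q [::].

Lemma eq_list_count (C : finType) (ls : seq {set C}) (Q Q' : seq C -> bool) :
  (forall s, size s = size ls -> Q s = Q' s) -> list_count ls Q = list_count ls Q'.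
Proof.
elim: ls Q Q' => [|A ls IH] Q Q' eQ /=; first by rewrite eQ.
by apply: eq_bigr => a _; apply: IH => s sz; apply: eQ; rewrite /= sz.
Qed.

Section ListFunctions.
Variables (T C : finType) (L : T -> {set C}).
Implicit Types (R : pred {ffun T -> C}) (x y : T) (a b : C).

Definition list_funs R : {set {ffun T -> C}} :=
  [set f : {ffun T -> C} | [forall v, f v \in L v] && R f].

Definition indep_of R x :=
  forall f g : {ffun T -> C}, (forall v, v != x -> f v = g v) -> R f = R g.

Lemma card_list_funs_fiber R x :
  #|list_funs R| = \sum_(a in L x) #|list_funs (fun f => R f && (f x == a))|.
Proof.
rewrite -sum1_card (partition_big (fun f : {ffun T -> C} => f x) (mem (L x))) /=.
  apply: eq_bigr => a _; rewrite -sum1_card; apply: eq_bigl => f.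
  by rewrite !inE andbA.
by move=> f; rewrite inE => /andP[/forallP].
Qed.

Lemma card_list_funs_fiber_le R x a b : indep_of R x -> a \in L x ->
  #|list_funs (fun f => R f && (f x == b))| <= #|list_funs (fun f => R f && (f x == a))|.
Proof.
move=> Rx aL; pose upd (f : {ffun T -> C}) := [ffun v => if v == x then a else f v].
rewrite -(card_in_imset (f := upd)).
  apply: subset_leq_card; apply/subsetP => _ /imsetP[f + ->].
  rewrite !inE => /and3P[/forallP fL Rf _]; apply/and3P; split.
  - by apply/forallP => v; rewrite ffunE; case: eqP => [->|].
  - by rewrite -(Rx f) // => v /negPf vx; rewrite ffunE vx.
  - by rewrite ffunE eqxx.
move=> f g; rewrite !inE => /and3P[_ _ /eqP fx] /and3P[_ _ /eqP gx] /ffunP efg.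
apply/ffunP => v; have := efg v; rewrite !ffunE; case: eqP => // -> _.
by rewrite fx gx.
Qed.

Lemma card_list_funs_indep R x a : indep_of R x -> a \in L x ->
  #|L x| * #|list_funs (fun f => R f && (f x == a))| = #|list_funs R|.
Proof.
move=> Rx aL; rewrite (card_list_funs_fiber R x) -sum_nat_const.
by apply: eq_bigr => b bL; apply/eqP; rewrite eqn_leq !card_list_funs_fiber_le.
Qed.

Lemma card_list_funs_seq m p (Q : seq C -> bool) : (forall v, #|L v| = m) -> uniq p ->
  m ^ size p * #|list_funs (fun f => Q (map f p))|
   = list_count (map L p) Q * #|list_funs predT|.
Proof.
move=> Lm; elim: p Q => [|x p IH] Q /=.
  move=> _; rewrite mul1n; case: (Q [::]); rewrite ?mul1n // mul0n.
  by apply: eq_card0 => f; rewrite inE andbF.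
case/andP => xp up; rewrite (card_list_funs_fiber _ x) expnS big_distrr big_distrl /=.
apply: eq_bigr => a aL; rewrite -IH // [m * _]mulnC -mulnA; congr (_ * _).
rewrite -(Lm x) -[RHS](card_list_funs_indep _ aL).
  congr (_ * _); apply: eq_card => f; rewrite !inE.
  by case: eqP => [->|]; rewrite ?andbF.
move=> f g efg; congr Q; congr (_ :: _); apply/eq_in_map => v vp; apply: efg.
by apply: contraNneq xp => <-.
Qed.

Lemma card_list_funsT m : (forall v, #|L v| = m) -> #|list_funs predT| = m ^ #|T|.
Proof.
move=> Lm; have -> : #|list_funs predT| = #|family (fun v => mem (L v))|.
  by apply: eq_card => f; rewrite !inE andbT.
rewrite card_family /image_mem cardE; elim: (enum T) => //= v s ->.
by rewrite Lm expnS.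
Qed.

Lemma card_list_funs_pendant R x y : x != y -> indep_of R x ->
  #|L x| * #|list_funs (fun f => R f && (f x != f y))|
   = \sum_(f in list_funs R) #|[set a in L x | a != f y]|.
Proof.
move=> xy Rx; rewrite (card_list_funs_fiber _ x) big_distrr /=.
transitivity (\sum_(a in L x) #|list_funs (fun f => R f && (a != f y))|).
  apply: eq_bigr => a aL.
  rewrite -[RHS](card_list_funs_indep _ aL).
    congr (_ * _); apply: eq_card => f; rewrite !inE.
    by case: (f x =P a) => [->|]; rewrite ?andbF.
  by move=> f g efg; rewrite (Rx f g efg) (efg y) // eq_sym.
under eq_bigr do rewrite -sum1_card.
under [RHS]eq_bigr do rewrite -sum1_card.
rewrite (exchange_big_dep (fun f => f \in list_funs R)) /=; last first.
  by move=> a f _; rewrite !inE => /and3P[-> ->].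
apply: eq_bigr => f; rewrite inE => /andP[fL Rf]; apply: eq_bigl => a.
by rewrite !inE fL Rf.
Qed.

End ListFunctions.

Section Minimality.
Variables (T : finType).
Implicit Types (r e : rel T) (S : {set T}).

Lemma P_listE r N (L : T -> {set 'I_N}) : P_list r L = #|list_funs L (@properb T r N)|.
Proof. by []. Qed.

Lemma chrom_polyE r m : chrom_poly r m = P_list r (fun _ => [set: 'I_m]).
Proof.
apply: eq_card => f; rewrite !inE; case: properb; rewrite ?andbF ?andbT //.
by apply/esym/forallP => v; rewrite inE.
Qed.

Definition const_minimal r m := forall N (L : T -> {set 'I_N}),
  m_assignment m L -> P_list r (fun _ => [set: 'I_m]) <= P_list r L.

Lemma const_minimal_list_color_function r m : const_minimal r m ->
  list_color_function_is r m (chrom_poly r m).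
Proof.
move=> rm; split; last by move=> N L Lm; rewrite chrom_polyE rm.
exists m, (fun _ => [set: 'I_m]); split; last by rewrite chrom_polyE.
by move=> v; rewrite cardsT card_ord.
Qed.

Lemma const_minimal_seq r m (Q : forall C : eqType, seq C -> bool) : 0 < m ->
  (forall N (L : T -> {set 'I_N}), m_assignment m L -> exists p, [/\ uniq p,
     forall N (f : {ffun T -> 'I_N}), properb r f = Q _ (map f p) &
     list_count (map (fun _ => [set: 'I_m]) p) (Q _) <= list_count (map L p) (Q _)]) ->
  const_minimal r m.
Proof.
move=> m_gt0 ex_p N L Lm; have [p [up rQ le_count]] := ex_p N L Lm.
have cm : m_assignment m (fun _ : T => [set: 'I_m]) by move=> v; rewrite cardsT card_ord.
have PE N' (L' : T -> {set 'I_N'}) :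
    P_list r L' = #|list_funs L' (fun f => Q _ (map f p))|.
  by apply: eq_card => f; rewrite !inE rQ.
rewrite !PE -(leq_pmul2l (m := m ^ size p)) ?expn_gt0 ?m_gt0 //.
rewrite (card_list_funs_seq _ Lm up) (card_list_funs_seq _ cm up).
by rewrite !(card_list_funsT (m := m)) // leq_mul2r le_count ?orbT.
Qed.

Definition restrict r S : rel T := fun u v => [&& u \in S, v \in S & r u v].

Lemma const_minimal_pendant e m S v : 0 < m -> symmetric e -> irreflexive e ->
  v \in S -> deg_in e S v = 1 ->
  const_minimal (restrict e (S :\ v)) m -> const_minimal (restrict e S) m.
Proof.
move=> m_gt0 e_sym e_irr vS /eqP/cards1P[w wE] IH N L Lm.
have eS u : (u \in S) && e v u = (u == w).
  by have /setP/(_ u) := wE; rewrite !inE.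
have /andP[wS evw] : (w \in S) && e v w by rewrite eS.
have vw : v != w by apply/eqP => vw; move: evw; rewrite vw e_irr.
have split_proper N' (f : {ffun T -> 'I_N'}) : properb (restrict e S) f =
    properb (restrict e (S :\ v)) f && (f v != f w).
  apply/idP/andP => [/forallP pf|[/forallP pf fvw]].
    split; last by have /forallP/(_ w) := pf v; rewrite /restrict vS wS evw.
    apply/forallP => a; apply/forallP => b; apply/implyP.
    rewrite /restrict !inE => /and3P[/andP[_ aS] /andP[_ bS] eab].
    by have /forallP/(_ b) := pf a; rewrite /restrict aS bS eab.
  apply/forallP => a; apply/forallP => b; apply/implyP => /and3P[aS bS eab].
  have [av|av] := eqVneq a v.
    by have := eS b; rewrite bS -av eab => /esym/eqP ->; rewrite av.
  have [bv|bv] := eqVneq b v.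
    by have := eS a; rewrite aS -bv e_sym eab => /esym/eqP ->; rewrite bv eq_sym.
  by have /forallP/(_ b) := pf a; rewrite /restrict !inE aS bS eab av bv.
have indep N' : indep_of (@properb T (restrict e (S :\ v)) N') v.
  move=> f g efg; apply: eq_forallb => a; apply: eq_forallb => b.
  rewrite /restrict !inE; have [->|av] := eqVneq a v; first by [].
  by have [->|bv] := eqVneq b v; rewrite ?andbF //= !efg.
have PE N' (L' : T -> {set 'I_N'}) : m_assignment m L' -> m * P_list (restrict e S) L' =
    \sum_(f in list_funs L' (@properb _ (restrict e (S :\ v)) N')) #|[set a in L' v | a != f w]|.
  move=> L'm; rewrite -(card_list_funs_pendant L' vw (indep N')) L'm; congr (_ * _).
  by apply: eq_card => f; rewrite !inE split_proper.
have cm : m_assignment m (fun _ : T => [set: 'I_m]) by move=> u; rewrite cardsT card_ord.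
rewrite -(leq_pmul2l m_gt0) !PE //.
apply: leq_trans (_ : #|list_funs (fun=> [set: 'I_m]) (@properb _ (restrict e (S :\ v)) m)| * m.-1 <= _).
  rewrite -sum_nat_const; apply: leq_sum => f _.
  have := cardsD1 (f w) [set: 'I_m]; rewrite inE cardsT card_ord add1n => mE.
  rewrite [X in _ <= X.-1]mE.
  by apply: eq_leq; apply: eq_card => a; rewrite !inE andbT.
apply: leq_trans (_ : #|list_funs L (@properb _ (restrict e (S :\ v)) N)| * m.-1 <= _).
  by rewrite leq_mul2r -!P_listE IH ?orbT.
rewrite -sum_nat_const; apply: leq_sum => f _.
apply: leq_trans (card_neq_ge (f w) (Lm v)) _.
by apply: eq_leq; apply: eq_card => a; rewrite !inE.
Qed.

Lemma const_minimal_core_step e m S : 0 < m -> symmetric e -> irreflexive e ->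
  const_minimal (restrict e (core_step e S)) m -> const_minimal (restrict e S) m.
Proof.
move=> m_gt0 e_sym e_irr; rewrite /core_step; case: pickP => // v /andP[vS /eqP dv].
exact: const_minimal_pendant.
Qed.

Lemma const_minimal_core e m : 0 < m -> symmetric e -> irreflexive e ->
  const_minimal (restrict e (core e)) m -> const_minimal e m.
Proof.
move=> m_gt0 e_sym e_irr; rewrite /core => core_min.
have : const_minimal (restrict e setT) m.
  elim: #|T| core_min => // n IH; rewrite iterS => /const_minimal_core_step h.
  exact/IH/h.
move=> h N L Lm; have PE N' (L' : T -> {set 'I_N'}) : P_list e L' = P_list (restrict e setT) L'.
  apply: eq_card => f; rewrite !inE; congr (_ && _).
  by apply: eq_forallb => a; apply: eq_forallb => b; rewrite /restrict !inE.
by rewrite !PE h.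
Qed.
End Minimality.

Section CoreCases.
Variables (T : finType) (e : rel T).
Implicit Types (S : {set T}) (p : seq T).

Lemma const_minimal_K1 S m : 0 < m ->
  induced_iso e S K1_rel -> const_minimal (restrict e S) m.
Proof.
move=> m_gt0 [h [_ [hS he]]].
apply: (@const_minimal_seq _ _ _ (fun _ _ => true)) => // N L Lm; exists [::]; split=> //.
move=> N' f; apply/forallP => u; apply/forallP => v; apply/implyP.
by case/and3P => /hS[i <-] /hS[j <-]; rewrite -he.
Qed.

Definition K23_proper (C : eqType) (s : seq C) : bool :=
  if s is [:: a; b; c; d; x] then
    [&& (c != a) && (c != b), (d != a) && (d != b) & (x != a) && (x != b)]
  else false.

Lemma list_count_K23 (C : finType) (A B L1 L2 L3 : {set C}) :
  list_count [:: A; B; L1; L2; L3] (@K23_proper C) = sum_pairs L1 L2 L3 A B.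
Proof.
apply: eq_bigr => a _; apply: eq_bigr => b _ /=.
have cE (L : {set C}) : \sum_(x in L) ((x != a) && (x != b) : nat)
    = #|[set x in L | (x != a) && (x != b)]|.
  rewrite -sum1_card big_mkcond [RHS]big_mkcond /=; apply: eq_bigr => x _.
  by rewrite !inE; case: (x \in L).
rewrite -!cE -mulnA big_distrl /=; apply: eq_bigr => c _.
rewrite big_distrl big_distrr /=; apply: eq_bigr => d _.
by rewrite !big_distrr /=; apply: eq_bigr => x _; rewrite !mulnb.
Qed.

Lemma const_minimal_K23 S m : 1 < m ->
  induced_iso e S K23_rel -> const_minimal (restrict e S) m.
Proof.
move=> m_gt1 [h [h_inj [hS he]]].
apply: (@const_minimal_seq _ _ _ K23_proper) (ltnW m_gt1) _ => N L Lm.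
pose x k := h (inord k); exists [:: x 0; x 1; x 2; x 3; x 4]; split.
- have := map_inj_uniq h_inj [:: inord 0; inord 1; inord 2; inord 3; inord 4].
  by move=> /= ->; rewrite /= !inE -!val_eqE /= !inordK.
- move=> N' f; have hE k (lt_k5 : k < 5) : h (Ordinal lt_k5) = x k.
    by congr h; apply: val_inj; rewrite /= inordK.
  have eE i j : i < 5 -> j < 5 -> restrict e S (x i) (x j) = ((i < 2) != (j < 2)).
    move=> i5 j5; rewrite /restrict -he /K23_rel !inordK //.
    have xS k : x k \in S by apply/hS; exists (inord k).
    by rewrite !xS.
  apply/forallP/idP => [pf|].
    have ne i j : i < 5 -> j < 5 -> (i < 2) != (j < 2) -> f (x i) != f (x j).
      by move=> i5 j5 ij; have /forallP/(_ (x j)) := pf (x i); rewrite eE // ij.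
    by rewrite /K23_proper /= !ne.
  case/and3P => /andP[h1 h2] /andP[h3 h4] /andP[h5 h6] u.
  apply/forallP => v; apply/implyP => uv; have /and3P[/hS[i iu] /hS[j jv] _] := uv.
  move: uv; rewrite -iu -jv.
  case: i {iu} => [[|[|[|[|[|i]]]]] // i5]; case: j {jv} => [[|[|[|[|[|j]]]]] // j5];
    rewrite !hE eE // => _; by [| rewrite eq_sym].
- rewrite [leqLHS]list_count_K23 [leqRHS]list_count_K23 (sum_pairs_const m_gt1).
  by apply: sum_pairs_ge; rewrite ?Lm.
Qed.

Definition neq_rel (C : eqType) : rel C := [rel a b | a != b].

Lemma list_count0 (C : finType) (ls : seq {set C}) : list_count ls (fun=> false) = 0.
Proof. by elim: ls => //= A ls IH; rewrite big1. Qed.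

Lemma list_count_path (C : finType) z c (ls : seq {set C}) :
  list_count ls (fun s => path (@neq_rel C) c (rcons s z)) = walks z c ls.
Proof.
elim: ls c => [|A ls IH] c; first by rewrite /= andbT.
rewrite /= [RHS]big_mkcondr /=; apply: eq_bigr => a aA.
rewrite -IH; case: (eqVneq a c) => [->|ac] /=.
  by rewrite -[RHS](list_count0 ls); apply: eq_list_count => s _; rewrite {1}/neq_rel /= eqxx.
by apply: eq_list_count => s _; rewrite {1}/neq_rel /= eq_sym ac.
Qed.

Lemma list_count_cycle (C : finType) A (ls : seq {set C}) :
  list_count (A :: ls) (cycle (@neq_rel C)) = closed_walks A ls.
Proof. by apply: eq_bigr => a _; apply: list_count_path. Qed.

Definition induced_cycle S p := [/\ uniq p, S =i p &
  {in p &, forall x y, e x y = (y == next p x) || (x == next p y)}].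

Lemma induced_cycle_rot S p i : induced_cycle S p -> induced_cycle S (rot i p).
Proof.
case=> up Sp ep; split; first by rewrite rot_uniq.
  by move=> x; rewrite mem_rot.
by move=> x y; rewrite !mem_rot => xp yp; rewrite !next_rot // ep.
Qed.

Lemma induced_cycle_properb S p N (f : {ffun T -> 'I_N}) : induced_cycle S p ->
  properb (restrict e S) f = cycle (@neq_rel _) (map f p).
Proof.
case=> up Sp ep; rewrite cycle_map; apply/forallP/idP => [pf|cf u].
  apply: cycle_from_next => // x xp /=.
  have /forallP/(_ (next p x)) := pf x.
  by rewrite /restrict !Sp xp mem_next xp ep ?mem_next // eqxx.
apply/forallP => v; apply/implyP; rewrite /restrict !Sp => /and3P[up' vp].
rewrite ep // => /orP[] /eqP->; first exact: (next_cycle cf).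
by rewrite eq_sym; apply: (next_cycle cf).
Qed.

Lemma cycle_lists_rot (U : eqType) p (L : T -> U) : uniq p -> 0 < size p ->
  exists i y s, rot i p = y :: s /\ (L y != L (last y s) \/ map L s = nseq (size s) (L y)).
Proof.
move=> up p_gt0; case: (boolP (all (fun x => L x == L (next p x)) p)) => [/allP al|].
  have : cycle [rel a b | L a == L b] p by apply: cycle_from_next.
  case: p up p_gt0 {al} => // y s _ _ cs; exists 0, y, s; rewrite rot0; split=> //; right.
  have tr : transitive [rel a b | L a == L b] by move=> b a c /= /eqP-> /eqP->.
  move: cs; rewrite /= rcons_path => /andP[/(order_path_min tr)/allP ys _].
  rewrite -(size_map L); apply/all_pred1P/allP => _ /mapP[x xs ->] /=.
  by rewrite eq_sym; apply: ys.
case/allPn => x xp Lx; have yp : next p x \in p by rewrite mem_next.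
have [i s rE] := rot_to yp; exists i, (next p x), s; split=> //; left.
have := cycle_next up; rewrite -(rot_cycle i) rE /= rcons_path => /andP[_ /eqP].
move/(congr1 (prev p)); rewrite !prev_next // => ->.
by rewrite eq_sym.
Qed.

Lemma const_minimal_cycle S p m : 1 < m -> induced_cycle S p ->
  3 < size p -> ~~ odd (size p) -> const_minimal (restrict e S) m.
Proof.
move=> m_gt1 Sp p4 podd.
apply: (@const_minimal_seq _ _ _ (fun C => cycle (@neq_rel C))) (ltnW m_gt1) _ => N L Lm.
have [up _ _] := Sp; have [i [y [s [rE Ls]]]] := cycle_lists_rot L up (ltnW (ltnW (ltnW p4))).
exists (rot i p); split; first by rewrite rot_uniq.
  by move=> N' f; apply/induced_cycle_properb/induced_cycle_rot.
rewrite rE.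
have sz : (size s).+1 = size p by rewrite -(size_rot i p) rE.
rewrite [leqLHS](list_count_cycle _ (map _ s)) [leqRHS](list_count_cycle _ (map _ s)).
have -> : [seq [set: 'I_m] | _ <- s] = nseq (size s) setT by elim: s {Ls rE sz} => //= ? ? ->.
rewrite (closed_walks_const (m := m)) ?cardsT ?card_ord ?(ltnW m_gt1) //; last first.
  by move: podd; rewrite -sz /= negbK.
case: s Ls sz {rE} => [|a [|b [|c s]]] Ls sz; try by rewrite -sz in p4.
have := @closed_walks_min _ m (L y) (L a) (L b) (L c) (map L s).
rewrite size_map; apply => //.
- by move: podd; rewrite -sz /= !negbK => /negbTE.
- by move=> F; rewrite -!map_cons => /mapP[x _ ->]; apply: Lm.
- by case: Ls => [h|h]; [left; rewrite last_map | right].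
Qed.

Lemma iso_induced_cycle S n : 0 < n -> induced_iso e S (cycle_rel n) ->
  exists2 p, induced_cycle S p & size p = n.
Proof.
move=> n_gt0 [h [h_inj [hS he]]]; exists (map h (enum 'I_n)); last by rewrite size_map size_enum_ord.
have up : uniq (map h (enum 'I_n)) by rewrite map_inj_uniq ?enum_uniq.
have nE i : next (enum 'I_n) i = ordS i.
  rewrite next_nth mem_enum /=; case E : (enum 'I_n) => [|y s].
    by have := mem_enum 'I_n i; rewrite E.
  have y0 : y = 0 :> nat by have := nth_enum_ord y n_gt0; rewrite E.
  rewrite -E index_enum_ord; apply: val_inj => /=.
  have [lt_i|ge_i] := ltnP i.+1 n.
    have := nth_enum_ord y lt_i; rewrite E /= => ->; by rewrite modn_small.
  have -> : i.+1 = n by have := ltn_ord i; lia.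
  rewrite modnn nth_default ?y0 //.
  have := size_enum_ord n; rewrite E /=; have := ltn_ord i; lia.
split=> //.
  move=> x; apply/idP/mapP => [/hS[i <-]|[i _ ->]]; first by exists i; rewrite ?mem_enum.
  by apply/hS; exists i.
move=> _ _ /mapP[i _ ->] /mapP[j _ ->]; rewrite -he.
rewrite !(next_map h_inj (enum_uniq 'I_n)) !nE !(inj_eq h_inj) /cycle_rel -!val_eqE /=.
by congr (_ || _); rewrite eq_sym.
Qed.

Lemma enum_chromatic_choosable_core : symmetric e -> irreflexive e ->
  chromatic_number e 2 ->
  [\/ induced_iso e (core e) K1_rel,
      exists2 k, 1 <= k & induced_iso e (core e) (cycle_rel (2 * k + 2))
    | induced_iso e (core e) K23_rel] -> enum_chromatic_choosable e.
Proof.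
move=> e_sym e_irr chi2 cores k m chik km.
have m_gt1 : 1 < m.
  apply: leq_trans km; rewrite ltnNge; apply/negP => k1.
  by have [_ /(_ k k1)] := chi2; apply; case: chik.
apply/const_minimal_list_color_function/const_minimal_core => //; first exact: ltnW.
case: cores => [iso|[l l_gt0 iso]|iso].
- by apply: const_minimal_K1 iso; apply: ltnW.
- have [|p Sp sp] := iso_induced_cycle _ iso; first by rewrite addn2.
  by apply: const_minimal_cycle Sp _ _; rewrite // sp; [lia | rewrite oddD oddM].
- exact: const_minimal_K23.
Qed.
End CoreCases.

Section Forcing.
Implicit Types (a b c d k : nat) (l : nat * nat) (ls : seq (nat * nat)) (s t : seq nat).

Definition in_pair l c := (c == l.1) || (c == l.2).
Definition split_pair l := l.1 != l.2.
Notation neq := (@neq_rel nat).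

Definition forces a ls s := forall t, all2 in_pair ls t -> path neq a t -> t = s.

Lemma forces_cons a b ls s : forces b ls s -> forces a ((a, b) :: ls) (b :: s).
Proof.
move=> bs [|c t] //= /andP[/orP[]/eqP-> lst]; first by rewrite /neq_rel /= eqxx.
by case/andP => _ /(bs _ lst) ->.
Qed.

Lemma forces_swap a c d k ls s :
  forces a (nseq k (c, d) ++ ls) s -> forces a (nseq k (d, c) ++ ls) s.
Proof.
move=> h t lt; apply: h; elim: k t lt => [|k IH] [|x t] //=.
by rewrite /in_pair /= orbC => /andP[-> /IH].
Qed.

Fixpoint alternate b a k := if k is k'.+1 then b :: alternate a b k' else [::].

Lemma forces_const_cat a b k ls s :
  forces (last a (alternate b a k)) ls s ->
  forces a (nseq k (a, b) ++ ls) (alternate b a k ++ s).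
Proof.
elim: k a b => [|k IH] a b //= h; apply: forces_cons.
exact/forces_swap/IH.
Qed.

Lemma forces_const a b k : forces a (nseq k (a, b)) (alternate b a k).
Proof.
rewrite -[nseq _ _]cats0 -[alternate _ _ _]cats0; apply: forces_const_cat.
by case.
Qed.

Lemma forces_const_r a b k : forces b (nseq k (a, b)) (alternate a b k).
Proof.
have := @forces_const b a k; rewrite -[nseq _ _]cats0 => /forces_swap.
by rewrite cats0.
Qed.

Lemma last_alternate a b k : last a (alternate b a k) = if odd k then b else a.
Proof. by elim: k a b => [|k IH] a b //=; rewrite IH; case: odd. Qed.

Lemma size_alternate a b k : size (alternate b a k) = k.
Proof. by elim: k a b => [|k IH] a b //=; rewrite IH. Qed.

(* Lists {a,b1}, {b1,b2}, ..., {bk,d} with fresh b_i. *)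
Lemma chain_neq k a d : a != d -> exists ls s, [/\ size ls = k.+1, size s = k.+1,
  all split_pair ls, forces a ls s & last a s = d].
Proof.
elim: k a => [|k IH] a ad.
  exists [:: (a, d)], [:: d]; split=> //=; first by rewrite andbT.
  by apply: forces_cons; case.
have bd : (a + d).+1 != d by lia.
have [ls [s [sl ss als fs lst]]] := IH _ bd.
exists ((a, (a + d).+1) :: ls), ((a + d).+1 :: s); split; rewrite /= ?sl ?ss ?als ?andbT //.
  rewrite /split_pair /=; lia.
exact: forces_cons.
Qed.

Lemma chain_any k a d : 1 < k -> exists ls s, [/\ size ls = k, size s = k,
  all split_pair ls, forces a ls s & last a s = d].
Proof.
case: k => [|[|k]] // _.
have bd : (a + d).+1 != d by lia.
have [ls [s [sl ss als fs lst]]] := chain_neq k bd.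
exists ((a, (a + d).+1) :: ls), ((a + d).+1 :: s); split; rewrite /= ?sl ?ss ?als ?andbT //.
  rewrite /split_pair /=; lia.
exact: forces_cons.
Qed.

(* Along the stick the two colours alternate, so the colour at its end is
   determined by [a]; a chain around the cycle then forbids that colour. *)
Lemma lollipop_lists a b k n : a != b -> 1 < n -> exists ls s, [/\ size ls = k + n,
  all split_pair ls, forces a ls s, size s = k + n & last a s = last a (take k s)].
Proof.
move=> ab n1; have [ls [s [sl ss als fs lst]]] :=
  chain_any (last a (alternate b a k)) (last a (alternate b a k)) n1.
exists (nseq k (a, b) ++ ls), (alternate b a k ++ s); split.
- by rewrite size_cat size_nseq sl.
- by rewrite all_cat als all_nseq /split_pair /= ab orbT.
- exact: forces_const_cat.
- by rewrite size_cat size_alternate ss.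
- by rewrite last_cat lst take_cat size_alternate ltnn subnn take0 cats0.
Qed.
End Forcing.

Section UniqueLists.
Variables (T : finType) (e : rel T).
Hypotheses (e_sym : symmetric e) (e_irr : irreflexive e).
Implicit Types (vs p q : seq T) (u v w x y z : T) (L : T -> nat * nat) (f g : T -> nat).
Notation neq := (@neq_rel nat).

Definition list_coloring L vs f :=
  all (fun v => in_pair (L v) (f v)) vs /\ {in vs &, forall x y, e x y -> f x != f y}.

Definition unique_listable vs := exists2 L, (forall v, split_pair (L v)) &
  forall f g, list_coloring L vs f -> list_coloring L vs g -> {in vs, f =1 g}.

Lemma list_coloring_sub L vs vs' f : {subset vs' <= vs} ->
  list_coloring L vs f -> list_coloring L vs' f.
Proof.
move=> sub [/allP h1 h2]; split; first by apply/allP => v /sub/h1.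
by move=> x y /sub xs /sub ys; apply: h2.
Qed.

(* Giving a new vertex the list of a neighbour forces its colour. *)
Lemma unique_listable_cons vs u v : u \in vs -> e u v ->
  unique_listable vs -> unique_listable (v :: vs).
Proof.
move=> uvs uv; have [vvs|vvs] := boolP (v \in vs).
  have sub : {subset v :: vs <= vs} by move=> x; rewrite inE => /predU1P[->|].
  have sub' : {subset vs <= v :: vs} by move=> x xs; rewrite inE xs orbT.
  case=> L Ls uniL; exists L => // f g Lf Lg x /sub.
  by apply: uniL; apply: list_coloring_sub sub' _.
have sub' : {subset vs <= v :: vs} by move=> x xs; rewrite inE xs orbT.
case=> L Ls uniL; pose L' x := if x == v then L u else L x.
have L'E x : x \in vs -> L' x = L x by rewrite /L'; case: eqP => // -> /(negP vvs).
have L'L f : list_coloring L' (v :: vs) f -> list_coloring L vs f.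
  move/(list_coloring_sub sub') => [/allP h1 h2]; split=> //.
  by apply/allP => x xs; rewrite -L'E // h1.
exists L' => [x|f g Lf Lg]; first by rewrite /L'; case: eqP.
have fg := uniL _ _ (L'L _ Lf) (L'L _ Lg) => x; rewrite inE => /predU1P[->|/fg //].
have fgu := fg u uvs.
have ins : (u \in v :: vs) * (v \in v :: vs) by rewrite !inE eqxx uvs orbT.
have [/andP[fv _] /(_ u v ins.1 ins.2 uv) fuv] := Lf.
have [/andP[gv _] /(_ u v ins.1 ins.2 uv) guv] := Lg.
have [/allP fL _] := L'L _ Lf; have := fL u uvs.
move: fv gv fuv guv; rewrite /L' eqxx /in_pair -fgu.
by case/orP => /eqP->; case/orP => /eqP->; rewrite // => a b; case/orP => E;
  rewrite E in a b.
Qed.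

Lemma lists_on vs ls : uniq vs -> size ls = size vs -> all split_pair ls ->
  exists2 L, (forall v, split_pair (L v)) & map L vs = ls.
Proof.
move=> uvs sls als; exists (fun v => nth (0, 1) ls (index v vs)).
  move=> v; have [lt|ge] := ltnP (index v vs) (size ls); last by rewrite nth_default.
  by apply: (allP als); apply: mem_nth.
apply: (@eq_from_nth _ (0, 1)); rewrite size_map // => i lt.
case: vs uvs sls lt => // x vs uvs sls lt.
by rewrite (nth_map x) // index_uniq.
Qed.

Lemma coloring_path L vs f u p : list_coloring L vs f -> {subset u :: p <= vs} ->
  path e u p -> path neq (f u) (map f p) && all2 in_pair (map L p) (map f p).
Proof.
case=> /allP fL fe; elim: p u => //= v p IH u sub /andP[uv vp].
have uvs : u \in vs by apply: sub; rewrite inE eqxx.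
have vvs : v \in vs by apply: sub; rewrite !inE eqxx orbT.
have /andP[-> ->] := IH v (fun x xp => sub x (mem_behead (s := u :: v :: p) xp)) vp.
by rewrite fL // /neq_rel /= fe.
Qed.

Lemma coloring_forced L vs f u w p ls s : list_coloring L vs f ->
  {subset u :: rcons p w <= vs} -> path e u (rcons p w) -> map L p = ls ->
  forces (f u) ls s -> map f p = s /\ last (f u) s != f w.
Proof.
move=> Lf sub up pls fs.
have subp : {subset u :: p <= vs}.
  by move=> x xp; apply: sub; rewrite !inE mem_rcons inE in xp *; case/orP: xp => ->; rewrite ?orbT.
have := coloring_path Lf sub up; rewrite map_rcons rcons_path => /andP[/andP[fp lst] _].
have := coloring_path Lf subp; move: up; rewrite rcons_path => /andP[-> _] /(_ isT)/andP[_].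
by rewrite pls => /fs/(_ fp) <-.
Qed.

Lemma in_list L vs f v l : list_coloring L vs f -> v \in vs -> L v = l ->
  f v = l.1 \/ f v = l.2.
Proof. by case=> /allP fL _ /fL + <- => /orP[]/eqP; [left|right]. Qed.

Lemma unlistable vs L : (forall v, split_pair (L v)) ->
  (forall f, ~ list_coloring L vs f) -> unique_listable vs.
Proof. by move=> Ls Lf; exists L => // f g /Lf. Qed.

Lemma path_rcons_rev u w p : path e u (rcons p w) -> path e w (rcons (rev p) u).
Proof.
move=> up; have := rev_path e u (rcons p w); rewrite last_rcons belast_rcons.
rewrite rev_cons (eq_path (e' := e)) => [|x y]; last by rewrite /= e_sym.
by rewrite up.
Qed.

(* With lists {1,2} at both ends, the constant path forbids equal end colours
   and the two chains forbid the pairs (1,2) and (2,1). *)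
Lemma theta_odd_listable u w p1 p2 p3 : uniq (u :: w :: p1 ++ p2 ++ p3) ->
  path e u (rcons p1 w) -> path e u (rcons p2 w) -> path e u (rcons p3 w) ->
  ~~ odd (size p1) -> 0 < size p2 -> 0 < size p3 ->
  unique_listable (u :: w :: p1 ++ p2 ++ p3).
Proof.
move=> un pa1 pa2 pa3 o1; case E2 : (size p2) => [|k2] // _; case E3 : (size p3) => [|k3] // _.
have [l2 [s2 [z2 _ a2 f2 d2]]] := @chain_neq k2 1 2 isT.
have [l3 [s3 [z3 _ a3 f3 d3]]] := @chain_neq k3 2 1 isT.
have [||L Ls] := @lists_on _ ((1, 2) :: (1, 2) :: nseq (size p1) (1, 2) ++ l2 ++ l3) un.
- by rewrite /= !size_cat size_nseq z2 z3 E2 E3.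
- by rewrite /= !all_cat a2 a3 all_nseq orbT.
rewrite /= !map_cat => -[Lu Lw /eqP].
rewrite eqseq_cat ?size_map ?size_nseq // => /andP[/eqP L1].
rewrite eqseq_cat ?size_map ?z2 ?E2 // => /andP[/eqP L2 /eqP L3].
apply: unlistable Ls _ => f Lf.
have sub p : {subset p <= p1 ++ p2 ++ p3} ->
    {subset u :: rcons p w <= u :: w :: p1 ++ p2 ++ p3}.
  move=> sp x; rewrite !inE mem_rcons inE; case/or3P => [->|->|/sp->]; by rewrite ?orbT.
have sub1 := sub p1 _; have sub2 := sub p2 _; have sub3 := sub p3 _.
have {}sub1 := sub1 ltac:(by move=> x; rewrite !mem_cat => ->).
have {}sub2 := sub2 ltac:(by move=> x; rewrite !mem_cat => ->; rewrite orbT).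
have {}sub3 := sub3 ltac:(by move=> x; rewrite !mem_cat => ->; rewrite !orbT).
have fw : f w = 1 \/ f w = 2 by apply: in_list Lf _ Lw; rewrite !inE eqxx orbT.
have fu : f u = 1 \/ f u = 2 by apply: in_list Lf _ Lu; rewrite !inE eqxx.
case: fu => fu.
- have [_] := coloring_forced Lf sub1 pa1 L1 (eq_ind_r (fun a => forces a _ _) (@forces_const 1 2 _) fu).
  have [_] := coloring_forced Lf sub2 pa2 L2 (eq_ind_r (fun a => forces a _ _) f2 fu).
  rewrite fu d2 last_alternate (negPf o1).
  by case: fw => ->.
- have [_] := coloring_forced Lf sub1 pa1 L1 (eq_ind_r (fun a => forces a _ _) (@forces_const_r 1 2 _) fu).
  have [_] := coloring_forced Lf sub3 pa3 L3 (eq_ind_r (fun a => forces a _ _) f3 fu).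
  rewrite fu d3 last_alternate (negPf o1).
  by case: fw => ->.
Qed.

(* With lists {1,2} at [u] and {1,3} at [w], the paths [p1] and [p2] rule out
   the colour 2 at [u], and the chain on [p3] rules out 1 at [w]; the colours
   1 at [u] and 3 at [w] then propagate along all three paths. *)
Lemma theta_even_listable u w p1 p2 p3 : uniq (u :: w :: p1 ++ p2 ++ p3) ->
  path e u (rcons p1 w) -> path e u (rcons p2 w) -> path e u (rcons p3 w) ->
  odd (size p1) -> odd (size p2) -> 1 < size p3 ->
  unique_listable (u :: w :: p1 ++ p2 ++ p3).
Proof.
move=> un pa1 pa2 pa3 o1 o2 k3.
have [l3 [s3 [z3 _ a3 f3 d3]]] := @chain_any _ 1 1 k3.
have [||L Ls] := @lists_on _
  ((1, 2) :: (1, 3) :: nseq (size p1) (1, 2) ++ nseq (size p2) (2, 3) ++ l3) un.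
- by rewrite /= !size_cat !size_nseq z3.
- by rewrite /= !all_cat a3 !all_nseq !orbT.
rewrite /= !map_cat => -[Lu Lw /eqP].
rewrite eqseq_cat ?size_map ?size_nseq // => /andP[/eqP L1].
rewrite eqseq_cat ?size_map ?size_nseq // => /andP[/eqP L2 /eqP L3].
have sub p : {subset p <= p1 ++ p2 ++ p3} ->
    {subset u :: rcons p w <= u :: w :: p1 ++ p2 ++ p3}.
  move=> sp x; rewrite !inE mem_rcons inE; case/or3P => [->|->|/sp->]; by rewrite ?orbT.
have sub1 := sub p1 _; have sub2 := sub p2 _; have sub3 := sub p3 _.
have {}sub1 := sub1 ltac:(by move=> x; rewrite !mem_cat => ->).
have {}sub2 := sub2 ltac:(by move=> x; rewrite !mem_cat => ->; rewrite orbT).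
have {}sub3 := sub3 ltac:(by move=> x; rewrite !mem_cat => ->; rewrite !orbT).
have sub2r : {subset w :: rcons (rev p2) u <= u :: w :: p1 ++ p2 ++ p3}.
  by move=> x xp; apply: sub2; move: xp; rewrite !inE !mem_rcons !inE mem_rev orbCA.
exists L => // f g Lf Lg.
have forced h : list_coloring L (u :: w :: p1 ++ p2 ++ p3) h ->
    map h (u :: w :: p1 ++ p2 ++ p3) =
    1 :: 3 :: alternate 2 1 (size p1) ++ rev (alternate 2 3 (size p2)) ++ s3.
  move=> Lh.
  have hw : h w = 1 \/ h w = 3 by apply: in_list Lh _ Lw; rewrite !inE eqxx orbT.
  have hu : h u = 1 \/ h u = 2 by apply: in_list Lh _ Lu; rewrite !inE eqxx.
  case: hu => hu; last first.
    have [_] := coloring_forced Lh sub1 pa1 L1 (eq_ind_r (fun a => forces a _ _) (@forces_const_r 1 2 _) hu).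
    have [_] := coloring_forced Lh sub2 pa2 L2 (eq_ind_r (fun a => forces a _ _) (@forces_const 2 3 _) hu).
    by rewrite hu !last_alternate o1 o2; case: hw => ->.
  have [E1 _] := coloring_forced Lh sub1 pa1 L1 (eq_ind_r (fun a => forces a _ _) (@forces_const 1 2 _) hu).
  have [E3] := coloring_forced Lh sub3 pa3 L3 (eq_ind_r (fun a => forces a _ _) f3 hu).
  rewrite hu d3; case: hw => hw; rewrite hw // => _.
  have L2r : map L (rev p2) = nseq (size p2) (2, 3).
    rewrite map_rev L2; apply: (@eq_from_nth _ (0, 0)); rewrite size_rev // size_nseq => i lt.
    by rewrite nth_rev size_nseq // !nth_nseq lt; case: ifP => // /negP; lia.
  have [E2 _] := coloring_forced Lh sub2r (path_rcons_rev pa2) L2r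
    (eq_ind_r (fun a => forces a _ _) (@forces_const_r 2 3 _) hw).
  by rewrite hw in E2; rewrite /= !map_cat E1 E3 hu hw -E2 map_rev revK.
apply/eq_in_map; by rewrite !forced.
Qed.

Lemma K24_listable u w x1 x2 x3 x4 : uniq [:: u; w; x1; x2; x3; x4] ->
  {in [:: x1; x2; x3; x4], forall x, e u x && e x w} ->
  unique_listable [:: u; w; x1; x2; x3; x4].
Proof.
move=> un ed.
have [||L Ls [Lu Lw L1 L2 L3 L4]] :=
  @lists_on _ [:: (1, 2); (3, 4); (1, 3); (1, 4); (2, 3); (2, 4)] un => //.
apply: unlistable Ls _ => f Lf.
have ne x l : x \in [:: x1; x2; x3; x4] -> L x = l -> (f u, f w) <> l.
  move=> xin Lx E; have xvs : x \in [:: u; w; x1; x2; x3; x4] by rewrite 2!inE xin !orbT.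
  have := in_list Lf xvs Lx; have /andP[ux xw] := ed x xin.
  have [_ fe] := Lf; have := fe u x _ xvs ux; have := fe x w xvs _ xw.
  rewrite !inE !eqxx orbT -E /= => /(_ isT) a /(_ isT) b [] c; by rewrite c eqxx in a b.
have [] := in_list Lf _ Lu; rewrite ?inE ?eqxx // => fu;
  have [] := in_list Lf _ Lw; rewrite ?inE ?eqxx ?orbT // => fw.
- by case: (ne x1 _ _ L1); rewrite ?inE ?eqxx ?orbT ?fu ?fw.
- by case: (ne x2 _ _ L2); rewrite ?inE ?eqxx ?orbT ?fu ?fw.
- by case: (ne x3 _ _ L3); rewrite ?inE ?eqxx ?orbT ?fu ?fw.
- by case: (ne x4 _ _ L4); rewrite ?inE ?eqxx ?orbT ?fu ?fw.
Qed.

Definition lollipop u q c := [/\ path e u (q ++ c), e (last u (q ++ c)) (last u q) & 1 < size c].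

Lemma lollipop_forbids L vs f u q c ls s : lollipop u q c -> list_coloring L vs f ->
  {subset u :: q ++ c <= vs} -> map L (q ++ c) = ls -> forces (f u) ls s ->
  last (f u) s = last (f u) (take (size q) s) -> False.
Proof.
move=> [pa el _] Lf sub Lls fs.
have /andP[fp fl] := coloring_path Lf sub pa; rewrite Lls in fl.
rewrite -(fs _ fl fp) map_cat take_cat size_map ltnn subnn take0 cats0 -map_cat !last_map.
apply/eqP; have [_ fe] := Lf; apply: fe el; apply: sub; first exact: mem_last.
by have := mem_last u q; rewrite !inE mem_cat; case/orP => ->; rewrite ?orbT.
Qed.

Lemma dumbbell_listable u q1 c1 q2 c2 : uniq (u :: (q1 ++ c1) ++ q2 ++ c2) ->
  lollipop u q1 c1 -> lollipop u q2 c2 -> unique_listable (u :: (q1 ++ c1) ++ q2 ++ c2).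
Proof.
move=> un lo1 lo2; have [_ _ n1] := lo1; have [_ _ n2] := lo2.
have [l1 [s1 [z1 a1 f1 t1 d1]]] := @lollipop_lists 1 2 (size q1) _ isT n1.
have [l2 [s2 [z2 a2 f2 t2 d2]]] := @lollipop_lists 2 1 (size q2) _ isT n2.
have [||L Ls] := @lists_on _ ((1, 2) :: l1 ++ l2) un.
- by rewrite /= !size_cat z1 z2.
- by rewrite /= !all_cat a1 a2.
rewrite /= map_cat => -[Lu /eqP]; rewrite eqseq_cat ?size_map ?size_cat ?z1 //.
case/andP => /eqP L1 /eqP L2; apply: unlistable Ls _ => f Lf.
have [] := in_list Lf _ Lu; rewrite ?inE ?eqxx // => fu.
- apply: (lollipop_forbids lo1 Lf _ L1 (eq_ind_r (fun a => forces a _ _) f1 fu)).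
    by move=> x; rewrite !inE [in X in _ -> X]mem_cat => /orP[]->; rewrite ?orbT.
  by rewrite fu.
- apply: (lollipop_forbids lo2 Lf _ L2 (eq_ind_r (fun a => forces a _ _) f2 fu)).
    by move=> x; rewrite !inE [in X in _ -> X]mem_cat => /orP[]->; rewrite ?orbT.
  by rewrite fu.
Qed.
End UniqueLists.

Section Core.
Variables (T : finType) (e : rel T).
Hypotheses (e_sym : symmetric e) (e_irr : irreflexive e).
Implicit Types (A S : {set T}) (u v w x y : T).

Definition cut_connected S := forall A, A \proper S -> A != set0 ->
  exists u v, [/\ u \in A, v \in S :\: A & e u v].

Lemma connected_cut : connected e -> cut_connected setT.
Proof.
move=> conn A /properP[_ [y _ yA]] /set0Pn[x xA].
have /connectP[p] := conn x y; elim: p x xA => [|z p IH] x xA /=.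
  by move=> _ yx; rewrite yx xA in yA.
case/andP => xz zp yE; have [zA|zA] := boolP (z \in A); first exact: IH zp yE.
by exists x, z; rewrite !inE zA.
Qed.

Lemma core_step_cut S : cut_connected S -> cut_connected (core_step e S).
Proof.
rewrite /core_step; case: pickP => // v /andP[vS /cards1P[w wE]] conn A pA A0.
have eS u : (u \in S) && e v u = (u == w) by have /setP/(_ u) := wE; rewrite !inE.
have vA : v \notin A.
  by apply/negP => /(subsetP (proper_sub pA)); rewrite !inE eqxx.
have sA : A \subset S by apply: subset_trans (proper_sub pA) (subsetDl _ _).
have [wA|wA] := boolP (w \in A); last first.
  have [|u [x [uA]]] := conn A _ A0.
    by apply/properP; split=> //; exists v.
  rewrite !inE => /andP[xA xS] ux; exists u, x; split=> //; rewrite !inE xA xS andbT /=.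
  apply: contraNneq wA => xv; rewrite xv in ux.
  by have := eS u; rewrite e_sym ux (subsetP sA) // => /esym/eqP <-.
have [||u [x []]] := conn (v |: A).
- case/properP: pA => _ [z]; rewrite !inE => /andP[zv zS] zA; apply/properP; split.
    by rewrite subUset sub1set vS.
  by exists z; rewrite // !inE negb_or zv.
- by apply/set0Pn; exists v; rewrite !inE eqxx.
rewrite !inE negb_or => uA /andP[/andP[xv xA] xS] ux.
have uA' : u \in A.
  case/predU1P: uA ux => [->|//] vx; have := eS x; rewrite xS vx => /esym/eqP xw.
  by rewrite xw wA in xA.
by exists u, x; rewrite !inE xv xA xS.
Qed.

Lemma core_step_neq0 S : S != set0 -> core_step e S != set0.
Proof.
rewrite /core_step; case: pickP => // v /andP[vS /cards1P[w wE]] _.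
have /setP/(_ w) := wE; rewrite !inE eqxx => /andP[wS vw].
apply/set0Pn; exists w; rewrite !inE wS andbT.
by apply: contraTneq vw => ->; rewrite e_irr.
Qed.

Lemma core_cut : connected e -> cut_connected (core e).
Proof.
move=> /connected_cut; rewrite /core; move: [set: T]; elim: #|T| => //= n IH S h.
exact/core_step_cut/IH.
Qed.

Lemma core_neq0 : 0 < #|T| -> core e != set0.
Proof.
rewrite -cardsT card_gt0 /core; move: [set: T]; elim: #|T| => //= n IH S h.
exact/core_step_neq0/IH.
Qed.

Lemma core_step_card S : core_step e S = S \/ #|core_step e S| < #|S|.
Proof.
rewrite /core_step; case: pickP => [v /andP[vS _]|]; last by left.
by right; rewrite (cardsD1 v S) vS.
Qed.

Lemma core_fixed : core_step e (core e) = core e.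
Proof.
rewrite /core; set n := #|T|.
have : core_step e (iter n (core_step e) setT) = iter n (core_step e) setT \/
       #|iter n (core_step e) setT| + n <= #|T|.
  elim: n => [|n [IH|IH]] /=; first by right; rewrite addn0 max_card.
    by left; rewrite !IH.
  have [E|lt] := core_step_card (iter n (core_step e) setT); first by left; rewrite !E.
  by right; rewrite addnS; apply: leq_trans IH; rewrite ltn_add2r.
case=> // le; have /eqP : #|iter n (core_step e) setT| = 0.
  by apply/eqP; rewrite -leqn0 -(leq_add2r n).
rewrite cards_eq0 => /eqP ->; rewrite /core_step; case: pickP => // v.
by rewrite inE.
Qed.

Lemma core_deg v : v \in core e -> deg_in e (core e) v != 1.
Proof.
move=> vS; apply/negP => dv; have := core_fixed; rewrite /core_step; case: pickP => [u /andP[uS _]|].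
  by move/setP/(_ u); rewrite !inE eqxx uS.
by move/(_ v); rewrite /= vS dv.
Qed.

Definition min_degree2 S := forall v x, v \in S -> exists y, [/\ y \in S, e v y & y != x].

Lemma core_K1_or_min_degree2 : connected e -> 0 < #|T| ->
  induced_iso e (core e) K1_rel \/ min_degree2 (core e).
Proof.
move=> /core_cut conn /core_neq0/set0Pn[v0 v0S].
have [v /andP[vS d0] | none] := pickP [pred v | (v \in core e) && (deg_in e (core e) v == 0)].
  have noe u : u \in core e -> e v u = false.
    move=> uS; apply: contraTF d0 => vu; rewrite -lt0n card_gt0.
    by apply/set0Pn; exists u; rewrite inE uS.
  have SE : core e = [set v].
    apply/eqP; rewrite eq_sym eqEsubset sub1set vS /=; apply/negPn/negP => nS.
    have [||u [x []]] := conn [set v].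
    - by rewrite properE sub1set vS.
    - by apply/set0Pn; exists v; rewrite inE.
    by rewrite !inE => /eqP-> /andP[_ /noe->].
  left; exists (fun=> v); split; first by move=> i j _; rewrite (ord1 i) (ord1 j).
  split=> [x|i j]; last by rewrite e_irr.
  by rewrite SE inE; split=> [/eqP->|[_ ->]] //; exists ord0.
right=> v x vS; have := core_deg vS; have := none v; rewrite /= vS /= /deg_in.
set N := [set _ in _ | _] => /negbT N0 N1; have /card_gt1P[a [b []]] : 1 < #|N|.
  by case: #|N| N0 N1 => [|[|]].
rewrite !inE => /andP[aS va] /andP[bS vb] ab.
have [ax|ax] := eqVneq a x; last by exists a.
by exists b; split=> //; rewrite -ax eq_sym.
Qed.
End Core.

Section Structure.
Variables (T : finType) (e : rel T).
Hypotheses (e_sym : symmetric e) (e_irr : irreflexive e).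
Implicit Types (A S : {set T}) (u v w x y : T) (p q c : seq T).

Definition ear u w p := [/\ path e u (rcons p w), uniq p & p != [::]].

(* Walk away from [A] along new vertices until forced back, either into [A]
   or onto the walk itself. *)
Lemma ear_or_lollipop S A u v : min_degree2 e S -> u \in A -> v \in S :\: A -> e u v ->
  (exists w p, [/\ w \in A, w != u, ear u w p & {subset p <= S :\: A}]) \/
  (exists q c, [/\ lollipop e u q c, uniq (q ++ c) & {subset q ++ c <= S :\: A}]).
Proof.
move=> md uA vSA uv.
suff main n p x : #|T| - size p = n -> path e u (rcons p x) -> uniq (rcons p x) ->
    {subset rcons p x <= S :\: A} ->
  (exists w p, [/\ w \in A, w != u, ear u w p & {subset p <= S :\: A}]) \/
  (exists q c, [/\ lollipop e u q c, uniq (q ++ c) & {subset q ++ c <= S :\: A}]).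
  apply: (main _ [::] v erefl); rewrite //= ?uv //.
  by move=> z; rewrite inE => /eqP->.
elim: n p x => [|n IH] p x np pa up sub.
  have : size (rcons p x) <= #|T| by rewrite -(card_uniqP up) max_card.
  by rewrite size_rcons; lia.
have xS : x \in S by have := sub x; rewrite mem_rcons !inE eqxx => /(_ isT)/andP[].
have [y [yS xy yl]] := md x (last u p) xS.
have [yA|yA] := boolP (y \in A).
  have [yu|yu] := eqVneq y u; last first.
    left; exists y, (rcons p x); split=> //; split=> //; last by case: (p).
    by rewrite rcons_path pa last_rcons.
  right; exists [::], (rcons p x); split=> //; split=> //=.
    by rewrite last_rcons -yu.
  by rewrite size_rcons; case: p yl {np pa up sub} => //=; rewrite yu eqxx.
have [yp|yp] := boolP (y \in rcons p x).
  right; have yp' : y \in p.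
    move: yp; rewrite mem_rcons inE => /predU1P[yx|//].
    by move: xy; rewrite yx e_irr.
  case/splitPr: yp' np pa up sub yl {yp} => p1 p2 np pa up sub yl.
  have E : rcons (p1 ++ y :: p2) x = rcons p1 y ++ rcons p2 x.
    by rewrite rcons_cat cat_rcons.
  exists (rcons p1 y), (rcons p2 x); rewrite -E; split=> //; split; rewrite -?E //.
    by rewrite !last_rcons.
  by rewrite size_rcons; case: p2 yl {np pa up sub E} => //=; rewrite last_cat /= eqxx.
apply: (IH (rcons p x) y); first by rewrite size_rcons; lia.
- by rewrite rcons_path pa last_rcons.
- by rewrite rcons_uniq yp.
- by move=> z; rewrite mem_rcons inE => /predU1P[->|/sub//]; rewrite inE yA yS.
Qed.

Lemma path_parity (phi : T -> bool) u p : (forall x y, e x y -> phi x != phi y) ->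
  path e u p -> phi (last u p) = odd (size p) (+) phi u.
Proof.
move=> phiE; elim: p u => //= v p IH u /andP[/phiE uv /IH ->].
by move: uv; case: (phi u) (phi v) (odd _) => [] [] [].
Qed.

Lemma unique_listable_extend vs : vs != [::] -> connected e ->
  unique_listable e vs -> exists2 vs', unique_listable e vs' & forall x, x \in vs'.
Proof.
move=> vs0 /connected_cut conn; have [n] := ubnP (#|T| - #|[set x in vs]|).
elim: n vs vs0 => // n IH vs vs0 lt Uvs.
have [/eqP full|nfull] := boolP ([set x in vs] == setT).
  by exists vs => // x; have := in_setT x; rewrite -full inE.
have [||u [v []]] := conn [set x in vs].
- by rewrite properEneq nfull subsetT.
- by case: vs vs0 {lt Uvs nfull} => // x vs _; apply/set0Pn; exists x; rewrite !inE eqxx.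
rewrite !inE andbT => uvs vvs uv; apply: (IH (v :: vs)) => //.
  have : #|[set x in v :: vs]| = #|[set x in vs]|.+1.
    rewrite set_cons cardsU1 inE vvs //.
  have := subset_leq_card (subsetT [set x in v :: vs]); rewrite cardsT.
  by move: lt; lia.
exact: unique_listable_cons uv Uvs.
Qed.
End Structure.

Ltac perm_count :=
  apply/permP => ?; rewrite /= ?count_cat /= ?count_cat ?count_rev;
  repeat match goal with |- context[nat_of_bool ?b] => generalize (nat_of_bool b) end;
  clear; lia.

Section Classification.
Variables (T : finType) (e : rel T) (phi : T -> bool).
Hypotheses (e_sym : symmetric e) (phiE : forall x y, e x y -> phi x != phi y).
Implicit Types (A S : {set T}) (s t u v w x y z : T) (p q c : seq T).

Let e_irr : irreflexive e.
Proof. by move=> x; apply/negP => /phiE; rewrite eqxx. Qed.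

Definition has_unique_listable := exists2 vs, vs != [::] & unique_listable e vs.

Definition K23 u w x y z :=
  uniq [:: u; w; x; y; z] /\ {in [:: x; y; z], forall t, e u t && e w t}.

Lemma theta_cases u w p1 p2 p3 : uniq (u :: w :: p1 ++ p2 ++ p3) ->
  path e u (rcons p1 w) -> path e u (rcons p2 w) -> path e u (rcons p3 w) ->
  p3 != [::] -> 0 < size p1 + size p2 ->
  has_unique_listable \/ exists x y z, [/\ p1 = [:: x], p2 = [:: y] & p3 = [:: z]].
Proof.
move=> un pa1 pa2 pa3; rewrite -size_eq0 -lt0n => n3 n12.
have := path_parity phiE pa1; have := path_parity phiE pa2; have := path_parity phiE pa3.
rewrite !last_rcons !size_rcons /= => -> /addIb/negb_inj o2 /addIb/negb_inj o1.
have [o3|o3] := boolP (odd (size p3)); last first.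
  left; have [z1|n1] := posnP (size p1).
    exists (u :: w :: p1 ++ p2 ++ p3) => //; apply: theta_odd_listable => //.
      by rewrite -o1.
    by move: n12; rewrite z1.
  exists (u :: w :: p2 ++ p1 ++ p3) => //; apply: theta_odd_listable => //.
    rewrite (@perm_uniq _ _ (u :: w :: p1 ++ p2 ++ p3)) // !perm_cons.
    by perm_count.
  by rewrite -o2.
rewrite o3 in o1 o2.
have [k3|k3] := ltnP 1 (size p3).
  left; exists (u :: w :: p1 ++ p2 ++ p3) => //; exact: theta_even_listable.
have [k2|k2] := ltnP 1 (size p2).
  left; exists (u :: w :: p1 ++ p3 ++ p2) => //; apply: theta_even_listable => //.
  rewrite (@perm_uniq _ _ (u :: w :: p1 ++ p2 ++ p3)) // !perm_cons.
  by perm_count.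
have [k1|k1] := ltnP 1 (size p1).
  left; exists (u :: w :: p2 ++ p3 ++ p1) => //; apply: theta_even_listable => //.
  rewrite (@perm_uniq _ _ (u :: w :: p1 ++ p2 ++ p3)) // !perm_cons.
  by perm_count.
right; move: o1 o2 o3 k1 k2 k3.
case: p1 {un pa1 n12} => [|x [|? ?]] // ; case: p2 {pa2} => [|y [|? ?]] //.
by case: p3 {pa3 n3} => [|z [|? ?]] // *; exists x, y, z.
Qed.

Lemma cycle_split p x y : uniq p -> cycle e p -> x \in p -> y \in p -> x != y ->
  exists i p1 p2, [/\ rot i p = x :: p1 ++ y :: p2, path e x (rcons p1 y) &
    path e x (rcons (rev p2) y)].
Proof.
move=> up cp xp yp xy; have [i p1 p2 _ _ E] := rot_to_arc up xp yp xy.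
exists i, p1, p2; split=> //; move: cp; rewrite -(rot_cycle i) E /= rcons_cat rcons_cons.
  by rewrite -cat_rcons cat_path => /andP[].
by rewrite -cat_rcons cat_path last_rcons => /andP[_] /(path_rcons_rev e_sym).
Qed.

Lemma cycle_ear p x y r : uniq p -> cycle e p -> 2 < size p -> x \in p -> y \in p ->
  x != y -> ear e x y r -> {in r, forall z, z \notin p} ->
  has_unique_listable \/ exists a b z, K23 x y a b z /\ {subset [:: a; b; z] <= p ++ r}.
Proof.
move=> up cp np xp yp xy [pa ur r0] rp.
have [i [p1 [p2 [E pa1 pa2]]]] := cycle_split up cp xp yp xy.
have memE : p =i x :: p1 ++ y :: p2 by move=> z; rewrite -E mem_rot.
have dis : uniq ((x :: p1 ++ y :: p2) ++ r).
  rewrite cat_uniq -E rot_uniq up ur andbT /=.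
  by apply/hasPn => t /rp; rewrite mem_rot.
have [||//|[a [b [z [E1 E2 E3]]]]] := theta_cases _ pa1 pa2 pa r0.
- rewrite (@perm_uniq _ _ ((x :: p1 ++ y :: p2) ++ r)) //.
  perm_count.
- by move: np; rewrite -(size_rot i) E /= size_cat /= size_rev; lia.
- by left.
have E2' : p2 = [:: b] by rewrite -(revK p2) E2.
subst; right; exists a, b, z; split; last first.
  by move=> t; rewrite mem_cat memE !inE => /or3P[]->; rewrite ?orbT.
split.
  rewrite (@perm_uniq _ _ (([:: x, a & [:: y; b]]) ++ [:: z])) //.
  by perm_count.
move: pa pa1 pa2; rewrite E2 /= !andbT => /andP[xz zy] /andP[xa ay] /andP[xb yb].
by move=> t; rewrite !inE (e_sym y) => /or3P[]/eqP->; apply/andP.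
Qed.

Lemma cycle_chord p x y : uniq p -> cycle e p -> x \in p -> y \in p -> e x y ->
  has_unique_listable \/ (y == next p x) || (x == next p y).
Proof.
move=> up cp xp yp xy; have nxy : x != y by apply: contraTneq xy => ->; rewrite e_irr.
have [i [p1 [p2 [E pa1 pa2]]]] := cycle_split up cp xp yp nxy.
have ur : uniq (rot i p) by rewrite rot_uniq.
case: p1 E pa1 => [|a p1] E pa1.
  by right; rewrite -!(next_rot i up) E /= eqxx eqxx.
case: (lastP p2) E pa2 => [|p2' b] E pa2.
  right; apply/orP; right; rewrite -(next_rot i up).
  have := cycle_next ur; rewrite {2}E /cycle rcons_path cats1 last_rcons.
  by case/andP => _ /eqP <-.
left; exists (x :: y :: [::] ++ (a :: p1) ++ rev (rcons p2' b)) => //.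
apply: theta_odd_listable => //; last by rewrite size_rev size_rcons.
  rewrite (@perm_uniq _ _ (x :: (a :: p1) ++ y :: rcons p2' b)) -?E //.
  by rewrite E; perm_count.
by rewrite /= xy.
Qed.

Lemma cycle_lollipop p u q c : uniq p -> cycle e p -> 2 < size p -> u \in p ->
  lollipop e u q c -> uniq (q ++ c) -> {in q ++ c, forall z, z \notin p} ->
  has_unique_listable.
Proof.
move=> up cp np upn lo uqc qcp; have [i s E] := rot_to upn.
exists (u :: ([::] ++ s) ++ q ++ c) => //; apply: dumbbell_listable => //.
  rewrite -cat_cons cat_uniq -E rot_uniq up uqc andbT /=.
  by apply/hasPn => z /qcp; rewrite mem_rot.
move: cp np; rewrite -(rot_cycle i) -(size_rot i) E /= rcons_path => /andP[us lst] ns.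
by split.
Qed.

Lemma K23_ear_uw u w x y z p : K23 u w x y z -> ear e u w p ->
  {in p, forall t, t \notin [:: u; w; x; y; z]} -> has_unique_listable.
Proof.
case=> un ed [pa up p0] pK.
have [ex ey ez] : [/\ e u x && e w x, e u y && e w y & e u z && e w z].
  by split; apply: ed; rewrite !inE eqxx ?orbT.
have dis : uniq ([:: u; w; x; y; z] ++ p).
  by rewrite cat_uniq un up andbT; apply/hasPn => t /pK.
have [|||//|[? [? [t [_ _ E]]]]] := @theta_cases u w [:: x] [:: y] p _ _ _ pa p0 isT.
- have : uniq (z :: u :: w :: [:: x] ++ [:: y] ++ p); last by case/andP.
  by rewrite (@perm_uniq _ _ ([:: u; w; x; y; z] ++ p)) //; perm_count.
- by case/andP: ex => ux wx /=; rewrite ux e_sym wx.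
- by case/andP: ey => ux wx /=; rewrite ux e_sym wx.
exists [:: u; w; x; y; z; t] => //; apply: K24_listable; first by rewrite E in dis.
move=> s; rewrite -[[:: x; y; z; t]]/([:: x; y; z] ++ [:: t]) mem_cat => /orP[/ed|].
  by rewrite (e_sym w).
by rewrite inE => /eqP->; move: pa; rewrite E /= andbT.
Qed.

Lemma K23_ear_ux u w x y z p : K23 u w x y z -> ear e u x p ->
  {in p, forall t, t \notin [:: u; w; x; y; z]} -> has_unique_listable.
Proof.
case=> un ed [pa up p0] pK.
have [/andP[ux wx] /andP[uy wy] _] : [/\ e u x && e w x, e u y && e w y & e u z && e w z].
  by split; apply: ed; rewrite !inE eqxx ?orbT.
have dis : uniq ([:: u; w; x; y; z] ++ p).
  by rewrite cat_uniq un up andbT; apply/hasPn => t /pK.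
exists (u :: x :: [::] ++ p ++ [:: y; w]) => //; apply: theta_odd_listable => //.
- have : uniq (z :: u :: x :: p ++ [:: y; w]); last by case/andP.
  rewrite (@perm_uniq _ _ ([:: u; w; x; y; z] ++ p)) //.
  by perm_count.
- by rewrite /= ux.
- by rewrite /= uy e_sym wy wx.
- by rewrite lt0n size_eq0.
Qed.

Lemma K23_ear_xy u w x y z p : K23 u w x y z -> ear e x y p ->
  {in p, forall t, t \notin [:: u; w; x; y; z]} -> has_unique_listable.
Proof.
case=> un ed [pa up p0] pK.
have [/andP[ux wx] /andP[uy wy] /andP[uz wz]] :
    [/\ e u x && e w x, e u y && e w y & e u z && e w z].
  by split; apply: ed; rewrite !inE eqxx ?orbT.
have dis : uniq ([:: u; w; x; y; z] ++ p).
  by rewrite cat_uniq un up andbT; apply/hasPn => t /pK.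
exists (u :: x :: [::] ++ [:: z; w] ++ y :: rev p) => //; apply: theta_odd_listable => //.
- rewrite (@perm_uniq _ _ ([:: u; w; x; y; z] ++ p)) //.
  by perm_count.
- by rewrite /= ux.
- by rewrite /= uz e_sym wz wx.
- by rewrite /= uy; apply: path_rcons_rev.
Qed.

Lemma K23_sym u w x y z : K23 u w x y z ->
  [/\ K23 w u x y z, K23 u w y x z & K23 u w y z x].
Proof.
case=> un ed; split; split.
- rewrite (@perm_uniq _ _ [:: u; w; x; y; z]) //; perm_count.
- by move=> t /ed; rewrite andbC.
- rewrite (@perm_uniq _ _ [:: u; w; x; y; z]) //; perm_count.
- by move=> t tin; apply: ed; move: tin; rewrite !inE orbCA.
- rewrite (@perm_uniq _ _ [:: u; w; x; y; z]) //; perm_count.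
- by move=> t tin; apply: ed; move: tin; rewrite !inE orbA orbC.
Qed.

Lemma ear_rev u w p : ear e u w p -> ear e w u (rev p).
Proof.
by case=> pa up p0; split; rewrite ?rev_uniq ?path_rcons_rev // -size_eq0 size_rev size_eq0.
Qed.

Lemma K23_ear u w x y z s t p : K23 u w x y z -> ear e s t p ->
  s \in [:: u; w; x; y; z] -> t \in [:: u; w; x; y; z] -> s != t ->
  {in p, forall r, r \notin [:: u; w; x; y; z]} -> has_unique_listable.
Proof.
move=> K ep sin tin st pK.
have Kp u' w' x' y' z' : perm_eq [:: u'; w'; x'; y'; z'] [:: u; w; x; y; z] ->
    {in p, forall r, r \notin [:: u'; w'; x'; y'; z']} /\
    {in rev p, forall r, r \notin [:: u'; w'; x'; y'; z']}.
  by move=> /perm_mem E; split=> r; rewrite ?mem_rev E; apply: pK.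
have orbit u' w' x' y' z' : K23 u' w' x' y' z' ->
    perm_eq [:: u'; w'; x'; y'; z'] [:: u; w; x; y; z] ->
    (s = u' /\ t = x') \/ (s = x' /\ t = u') \/ (s = x' /\ t = y') \/ (s = u' /\ t = w') ->
    has_unique_listable.
  move=> K' /Kp[pK1 pK2] [|[|[|]]] [Es Et]; subst.
  - exact: K23_ear_ux K' ep pK1.
  - exact: K23_ear_ux K' (ear_rev ep) pK2.
  - exact: K23_ear_xy K' ep pK1.
  - exact: K23_ear_uw K' ep pK1.
have [K1' K2 K3] := K23_sym K; have [K3' K4 K5] := K23_sym K3; have [K5' K6 _] := K23_sym K5.
have [K2' _ _] := K23_sym K2; have [K4' _ _] := K23_sym K4; have [K6' _ _] := K23_sym K6.
move: sin tin; rewrite !inE => /orP[/eqP Es|/or4P[]/eqP Es] /orP[/eqP Et|/or4P[]/eqP Et];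
 first [ by move: st; rewrite Es Et eqxx
       | by apply: (orbit _ _ _ _ _ K); [perm_count | tauto]
       | by apply: (orbit _ _ _ _ _ K1'); [perm_count | tauto]
       | by apply: (orbit _ _ _ _ _ K2); [perm_count | tauto]
       | by apply: (orbit _ _ _ _ _ K2'); [perm_count | tauto]
       | by apply: (orbit _ _ _ _ _ K3); [perm_count | tauto]
       | by apply: (orbit _ _ _ _ _ K3'); [perm_count | tauto]
       | by apply: (orbit _ _ _ _ _ K4); [perm_count | tauto]
       | by apply: (orbit _ _ _ _ _ K4'); [perm_count | tauto]
       | by apply: (orbit _ _ _ _ _ K5); [perm_count | tauto]
       | by apply: (orbit _ _ _ _ _ K5'); [perm_count | tauto]
       | by apply: (orbit _ _ _ _ _ K6); [perm_count | tauto]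
       | by apply: (orbit _ _ _ _ _ K6'); [perm_count | tauto]].
Qed.
End Classification.

Section CoreClassification.
Variables (T : finType) (e : rel T).
Hypothesis e_sym : symmetric e.
Implicit Types (A S : {set T}) (p q c : seq T).

Lemma induced_cycle_iso S p : 0 < size p -> induced_cycle e S p ->
  induced_iso e S (cycle_rel (size p)).
Proof.
case: p => [|x0 p0] //; set p := x0 :: p0 => n0 [up Sp ep].
pose h (i : 'I_(size p)) := nth x0 p i; exists h.
have h_inj : injective h.
  by move=> i j /eqP; rewrite nth_uniq ?ltn_ord // => /eqP/val_inj.
have nextE (i : 'I_(size p)) : next p (h i) = nth x0 p (i.+1 %% size p).
  rewrite next_nth mem_nth ?ltn_ord // {1}/p /h index_uniq ?ltn_ord //.
  have [lt|ge] := ltnP i.+1 (size p); first by rewrite modn_small.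
  have -> : i.+1 = size p by have := ltn_ord i; lia.
  rewrite modnn nth_default //; have := ltn_ord i; move: ge; rewrite /p /=; lia.
split=> //; split=> [x|i j].
  rewrite Sp; split=> [xp|[i <-]]; last exact/mem_nth/ltn_ord.
  by have lt := xp; rewrite -index_mem in lt; exists (Ordinal lt); apply: nth_index.
rewrite ep ?mem_nth ?ltn_ord // !nextE /cycle_rel !nth_uniq ?ltn_ord ?ltn_pmod //.
by congr (_ || _); rewrite eq_sym.
Qed.

Lemma K23_induced_iso (phi : T -> bool) S u w x y z : (forall a b, e a b -> phi a != phi b) ->
  K23 e u w x y z -> S =i [:: u; w; x; y; z] -> induced_iso e S K23_rel.
Proof.
move=> phiE [un ed] Sp; set p := [:: u; w; x; y; z] in un Sp.
pose h (i : 'I_5) := nth u p i; exists h.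
split; first by move=> i j /eqP; rewrite nth_uniq ?ltn_ord // => /eqP/val_inj.
split=> [a|].
  rewrite Sp; split=> [ap|[i <-]]; last by apply/mem_nth/(ltn_ord i).
  by have lt := ap; rewrite -index_mem in lt; exists (Ordinal lt); apply: nth_index.
have [/andP[ux wx] /andP[uy wy] /andP[uz wz]] :
    [/\ e u x && e w x, e u y && e w y & e u z && e w z].
  by split; apply: ed; rewrite !inE eqxx ?orbT.
have side (i : 'I_5) : phi (h i) = (i < 2) (+) ~~ phi u.
  move: (phiE _ _ ux) (phiE _ _ wx) (phiE _ _ uy) (phiE _ _ uz).
  case: i => [[|[|[|[|[|i]]]]] lt] //=; rewrite /h /=;
    by case: (phi u) (phi w) (phi x) (phi y) (phi z) => [] [] [] [] [].
have cross (i j : 'I_5) : i < 2 -> ~~ (j < 2) -> e (h i) (h j).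
  case: i => [[|[|i]] //= lt] _; by case: j => [[|[|[|[|[|j]]]]] //= lt'] _; rewrite /h /=.
move=> i j; rewrite /K23_rel; apply/idP/idP => [|/phiE]; last first.
  by rewrite !side; case: (i < 2) (j < 2) (phi u) => [] [] [].
case: (boolP (i < 2)) (boolP (j < 2)) => [i2|i2] [j2|j2] // _; first exact: cross.
by rewrite e_sym cross.
Qed.

Lemma core_classification (phi : T -> bool) S : (forall a b, e a b -> phi a != phi b) ->
  S != set0 -> cut_connected e S -> min_degree2 e S ->
  has_unique_listable e \/
  (exists2 k, 1 <= k & induced_iso e S (cycle_rel (2 * k + 2))) \/ induced_iso e S K23_rel.
Proof.
move=> phiE /set0Pn[v0 v0S] conn md.
have e_irr : irreflexive e by move=> x; apply/negP => /phiE; rewrite eqxx.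
have [p [up cp np pS]] : exists p, [/\ uniq p, cycle e p, 2 < size p & {subset p <= S}].
  have [v [vS v0v vv0]] := md v0 v0 v0S.
  have [|||[w [p [+ + _ _]]]|[q [c [[pa el nc] uqc sub]]]] :=
      @ear_or_lollipop _ _ e_irr S [set v0] v0 v md => //.
  - by rewrite inE.
  - by rewrite !inE vv0.
  - by rewrite inE => /eqP->; rewrite eqxx.
  have uv : uniq (v0 :: q ++ c).
    by rewrite cons_uniq uqc andbT; apply/negP => /sub; rewrite !inE eqxx.
  exists (last v0 q :: c); split.
  - move: uv; rewrite -cat_cons lastI cat_rcons; apply: subseq_uniq.
    exact: suffix_subseq.
  - rewrite /= rcons_path; move: pa el; rewrite cat_path last_cat => /andP[_ ->] ->.
    by [].
  - by [].
  - move=> x; rewrite inE => /predU1P[->|xc]; last first.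
      by have := sub x; rewrite mem_cat xc orbT inE => /(_ isT)/andP[].
    have := mem_last v0 q; rewrite inE => /predU1P[->//|xq].
    by have := sub (last v0 q); rewrite mem_cat xq => /(_ isT); rewrite inE => /andP[].
pose A := [set x in p].
have AS : A \subset S by apply/subsetP => x; rewrite inE => /pS.
have A0 : A != set0 by case: (p) np @A {AS} => // x p' _; apply/set0Pn; exists x; rewrite !inE eqxx.
have even_p : odd (size p) = false.
  case: (p) cp np {A A0 AS} => // x p' /= pa _.
  have := path_parity phiE pa; rewrite last_rcons size_rcons /=.
  by case: (odd _) (phi x) => [] [].
have [AE|AnS] := eqVneq A S.
  have Sp : S =i p by move=> x; rewrite -AE inE.
  have [x /andP[xp]|chordless] := pickP [pred x | (x \in p) &&
      [exists y, [&& y \in p, e x y & ~~ ((y == next p x) || (x == next p y))]]].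
    case/existsP => y /and3P[yp xy nxy].
    by have [|h] := cycle_chord e_sym phiE up cp xp yp xy; [left | rewrite h in nxy].
  right; left; exists (size p).-2./2; first by lia.
  have -> : 2 * (size p).-2./2 + 2 = size p by lia.
  apply: induced_cycle_iso; first by lia.
  split=> // x y xp yp; apply/idP/idP => [xy|].
    have := chordless x; rewrite /= xp => /existsP h; apply/negPn/negP => nxy; apply: h.
    by exists y; rewrite yp xy.
  by case/orP => /eqP ->; rewrite ?(next_cycle cp) // e_sym (next_cycle cp).
have prA : A \proper S by rewrite properEneq AnS.
have [u [v [uA vS uv]]] := conn A prA A0.
have up' : u \in p by rewrite inE in uA.
have out q : {subset q <= S :\: A} -> {in q, forall z, z \notin p}.
  by move=> sub z /sub; rewrite !inE => /andP[].
have [[w [r [wA wu er sub]]]|[q [c [lo uqc sub]]]] := ear_or_lollipop e_irr md uA vS uv; last first.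
  by left; apply: cycle_lollipop lo uqc (out _ sub).
have wp : w \in p by rewrite inE in wA.
have [||[x [y [z [K Ksub]]]]] := cycle_ear e_sym phiE up cp np up' wp _ er (out _ sub).
- by rewrite eq_sym.
- by left.
pose B := [set t in [:: u; w; x; y; z]].
have BS : B \subset S.
  apply/subsetP => t; rewrite inE -[[:: u; w; x; y; z]]/([:: u; w] ++ [:: x; y; z]) mem_cat.
  case/orP => [|/Ksub]; first by rewrite !inE => /orP[]/eqP->; apply: pS.
  by rewrite mem_cat => /orP[/pS//|/sub]; rewrite inE => /andP[].
have [BE|BnS] := eqVneq B S.
  right; right; apply: (K23_induced_iso phiE K) => t.
  by rewrite -BE inE.
have B0 : B != set0 by apply/set0Pn; exists u; rewrite !inE eqxx.
have [|s [v' [sB vS' sv]]] := conn B _ B0; first by rewrite properEneq BnS.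
have outB q : {subset q <= S :\: B} -> {in q, forall t, t \notin [:: u; w; x; y; z]}.
  by move=> sub' t /sub'; rewrite !inE => /andP[].
left; have [[t [r' [tB ts er' sub']]]|[q [c [lo uqc sub']]]] := ear_or_lollipop e_irr md sB vS' sv.
  rewrite inE in sB; rewrite inE in tB.
  by apply: (K23_ear e_sym phiE K er' sB tB _ (outB _ sub')); rewrite eq_sym.
have cyc x' y' z' : K23 e u w x' y' z' -> uniq [:: u; x'; w; y'] && cycle e [:: u; x'; w; y'].
  case=> un ed; apply/andP; split.
    have : uniq [:: z'; u; x'; w; y']; last by case/andP.
    by rewrite (@perm_uniq _ _ [:: u; w; x'; y'; z']) //; perm_count.
  have /andP[ux wx] := ed x' ltac:(by rewrite !inE eqxx).
  have /andP[uy wy] := ed y' ltac:(by rewrite !inE eqxx orbT).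
  by rewrite /= ux (e_sym x') wx wy (e_sym y') uy.
have [_ _ K3] := K23_sym K; have [_ K4 _] := K23_sym K3.
have fin x' y' z' : K23 e u w x' y' z' -> s \in [:: u; x'; w; y'] ->
    {subset [:: u; x'; w; y'] <= [:: u; w; x; y; z]} -> has_unique_listable e.
  move=> K' sin sub4; have /andP[u4 c4] := cyc _ _ _ K'.
  by apply: cycle_lollipop u4 c4 isT sin lo uqc _ => t /(outB _ sub'); apply/contra/sub4.
have [sz|sz] := eqVneq s z.
  apply: (fin _ _ _ K4); first by rewrite sz !inE eqxx ?orbT.
  by move=> t; rewrite !inE => /or4P[]->; rewrite ?orbT.
apply: (fin _ _ _ K); last by move=> t; rewrite !inE => /or4P[]->; rewrite ?orbT.
by move: sB; rewrite !inE (negPf sz) orbF => /or4P[]->; rewrite ?orbT.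
Qed.
End CoreClassification.

Lemma unique_listable_P_list (T : finType) (e : rel T) vs : (forall x, x \in vs) ->
  unique_listable e vs -> exists N (L : T -> {set 'I_N}), m_assignment 2 L /\ P_list e L <= 1.
Proof.
move=> full [L Ls uniL]; pose N := \max_v maxn (L v).1 (L v).2.
have ltN v : (L v).1 < N.+1 /\ (L v).2 < N.+1.
  by apply/andP; rewrite !ltnS -geq_max leq_bigmax.
exists N.+1, (fun v => [set inord (L v).1; inord (L v).2]); split=> [v|].
  have [l1 l2] := ltN v; rewrite cards2 -val_eqE /= !inordK //.
  by have := Ls v; rewrite /split_pair => ->.
apply/card_le1_eqP => f g.
have col (h : {ffun T -> 'I_N.+1}) :
    h \in [set h : {ffun T -> 'I_N.+1} | [forall v, h v \in [set inord (L v).1; inord (L v).2]] &&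
                properb e h] -> list_coloring e L vs (fun v => h v : nat).
  rewrite inE => /andP[/forallP hL /forallP he]; split.
    apply/allP => v _; have := hL v; have [l1 l2] := ltN v.
    by rewrite !inE -!val_eqE /= !inordK.
  by move=> x y _ _ xy; have /forallP/(_ y) := he x; rewrite xy -val_eqE.
move=> /col fL /col gL; apply/ffunP => v; apply: val_inj.
exact: (uniL _ _ gL fL v (full v)).
Qed.

Lemma chrom_poly2_gt1 (T : finType) (e : rel T) : 0 < #|T| -> colorable e 2 ->
  1 < chrom_poly e 2.
Proof.
move=> /card_gt0P[x _] [f fP]; apply/card_gt1P.
exists (finfun f), [ffun v => rev_ord (f v)]; split.
- by rewrite inE; apply/'forall_forallP => u v; apply/implyP => /fP/eqP; rewrite !ffunE.
- rewrite inE; apply/'forall_forallP => u v; apply/implyP => /fP/eqP; rewrite !ffunE.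
  by rewrite (inj_eq rev_ord_inj).
- apply/eqP => /ffunP/(_ x); rewrite !ffunE => /(congr1 val) /=.
  by case: (f x) => [[|[|]]].
Qed.

Theorem theorem10 (T : finType) (e : rel T) :
  symmetric e -> irreflexive e -> 0 < #|T| ->
  connected e -> chromatic_number e 2 ->
  (enum_chromatic_choosable e <->
     [\/ induced_iso e (core e) K1_rel,
         exists2 k, 1 <= k & induced_iso e (core e) (cycle_rel (2 * k + 2))
       | induced_iso e (core e) K23_rel]).
Proof.
move=> e_sym e_irr T0 conn chi2; split; last exact: enum_chromatic_choosable_core.
move=> ecc; have [_ minP] := ecc 2 2 chi2 (leqnn 2).
have [f fP] := chi2.1; pose phi v := f v == ord0.
have phiE a b : e a b -> phi a != phi b.
  move=> /fP; rewrite /phi -!val_eqE /=.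
  case: (f a) => [[|[|]]] //= i; case: (f b) => [[|[|]]] //= j; case; exact: val_inj.
have [iso|md] := core_K1_or_min_degree2 e_sym e_irr conn T0; first by constructor 1.
have [[vs vs0 Uvs]|[cyc|iso]] := core_classification e_sym phiE
    (core_neq0 e_irr T0) (core_cut e_sym conn) md; last 2 first.
- by constructor 2.
- by constructor 3.
have [vs' Uvs' full] := unique_listable_extend vs0 conn Uvs.
have [N [L [L2 P1]]] := unique_listable_P_list full Uvs'.
by have := leq_trans (minP N L L2) P1; rewrite leqNgt chrom_poly2_gt1 //; case: chi2.
Qed.
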